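(* For every $2\leq r<\omega$, the class $\mathbf{H}_r$ of all finite $r$-hypergraphs is an indecomposable algebraically trivial Fraïssé class.
   Context: Hypergraphs. For $2\le r<\omega$, $\mathbf{H}_r$ is the class of all finite structures in the language with one $r$-ary relation symbol $R$ in which $R$ is irreflexive ($R(\overline x)$ implies $x_i\ne x_j$ for all $i<j<r$) and symmetric (closed under all permutations of the coordinates). It is an algebraically trivial Fraïssé class. Theories and the ordering $\trianglelefteq$. $\mathbb{T}$ is the class of all complete first-order (possibly many-sorted) theories with infinite models that eliminate imaginaries; $\mathcal{L}_T$ is the language of $T$. A theory $T$ that may not eliminate imaginaries is freely identified with $T^{\mathrm{eq}}$. Fix a countably infinite set $A$. For $T\in\mathbb{T}$, $\mathbf{F}(T)$ is the set of injections $f:B\to M$, where $B\subset A$ is finite and $M$ is the universe of some model $\mathcal{M}\models T$, such that all $f(a)$, $a\in B$, lie in one sort, and for every $B_0\subsetneq B$ the type $\mathrm{tp}(f[B]/f[B_0])$ is non-algebraic. A sequence $\boldsymbol\phi=(\phi_0,\dots,\phi_{N-1})$ of $\mathcal{L}_T$-formulas is always finite and all free variables range over one common sort (the sort of $\boldsymbol\phi$); if $\phi_i=\phi_i(x_0,\dots,x_{n_i-1})$, then $\mathcal{L}_{\boldsymbol\phi}$ is the one-sorted language with signature $\{R_0^{(n_0)},\dots,R_{N-1}^{(n_{N-1})}\}$ (the languages of two sequences that coordinate-wise have the same arities are identified). $\mathbf{F}_{\boldsymbol\phi}(T)$ is the set of $f\in\mathbf{F}(T)$ with values in the sort of $\boldsymbol\phi$;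 for such $f:B\to M$, $B_{\boldsymbol\phi}(f)$ is the $\mathcal{L}_{\boldsymbol\phi}$-structure with universe $B$ and $R_i=\{\overline a\in B^{n_i}:\mathcal{M}\models\phi_i(f\overline a)\}$. $\mathrm{Age}_{\boldsymbol\phi}(T)=\{B_{\boldsymbol\phi}(f):f\in\mathbf{F}_{\boldsymbol\phi}(T)\}$ up to isomorphism. For $T_1,T_2\in\mathbb{T}$, $T_1\trianglelefteq T_2$ means: for every finite sequence $\boldsymbol\phi^1$ of $\mathcal{L}_{T_1}$-formulas there is a sequence $\boldsymbol\phi^2$ of $\mathcal{L}_{T_2}$-formulas, coordinate-wise of the same arities, with $\mathrm{Age}_{\boldsymbol\phi^1}(T_1)\subseteq\mathrm{Age}_{\boldsymbol\phi^2}(T_2)$. Fraïssé classes. A Fraïssé class is a class of finite structures in a one-sorted finite relational language having the hereditary, joint-embedding and amalgamation properties (HP, JEP, AP). $T_{\mathbf{K}}$ is the complete theory of the generic model (Fraïssé limit) of $\mathbf{K}$. $\mathbf{K}$ is algebraically trivial if $\mathrm{acl}^{\mathcal{M}}(X)=X$ for all $\mathcal{M}\models T_{\mathbf{K}}$ and $X\subseteq M$ (equivalently, $\mathbf{K}$ has disjoint-JEP and disjoint-AP). Indecomposability. Let $\mathbf{K}_0,\dots,\mathbf{K}_{n-1}$ be algebraically trivial Fraïssé classes in languages $\mathcal{L}_i$ with pairwise disjoint signatures. $\Pi_i\mathbf{K}_i$ is the class of finite structures $B=B_0\times\cdots\times B_{n-1}$ with $B_i\in\mathbf{K}_i$, in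 the language with signature $\bigcup_i\mathrm{sig}(\mathcal{L}_i)$, where for $R^{(r)}\in\mathrm{sig}(\mathcal{L}_i)$, $R^B=\{(\overline a_0,\dots,\overline a_{r-1})\in B^r:(a_{0,i},\dots,a_{r-1,i})\in R^{B_i}\}$. It has AP and JEP, hence a well-defined generic model. A factorization of an algebraically trivial Fraïssé class $\mathbf{K}$ with generic model $\mathcal{A}$ is a list $(\mathbf{K}_0,\dots,\mathbf{K}_{n-1})$, $n>1$, of such classes for which there is an injection $u:\mathcal{A}\to\mathcal{B}$ of universes, $\mathcal{B}$ the generic model of $\Pi_i\mathbf{K}_i$, such that for all $k$ and $\overline a,\overline a'\in\mathcal{A}^k$: $\mathrm{qftp}^{\mathcal{A}}(\overline a)=\mathrm{qftp}^{\mathcal{A}}(\overline a')\iff\mathrm{tp}^{\mathcal{B}}(u\overline a)=\mathrm{tp}^{\mathcal{B}}(u\overline a')$ (qftp = quantifier-free type). $\mathbf{K}$ is indecomposable if for every factorization $(\mathbf{K}_0,\dots,\mathbf{K}_{n-1})$ of $\mathbf{K}$ there is $i<n$ with $T_{\mathbf{K}}\trianglelefteq T_{\mathbf{K}_i}$. *)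

(* Defs.v *)
From mathcomp Require Import all_boot perm.
From mathcomp Require Import finmap.
From mathcomp Require Import boolp classical_sets functions cardinality.

Set Implicit Arguments.
Unset Strict Implicit.
Unset Printing Implicit Defensive.

Local Open Scope classical_set_scope.

(* A context is a map [G : V -> sorts L] from a type of variables to sorts, and
   a tuple in context [G] is a dependent function [forall v, M (G v)].  Taking
   the variable type arbitrary allows parameters to be used as variables, see
   [tp_over].  Empty sorts are permitted. *)

Record language := Language {
  sorts : Type;
  fsym : Type;
  far  : fsym -> nat;
  fdom : forall f : fsym, 'I_(far f) -> sorts;
  fcod : fsym -> sorts;
  rsym : Type;
  rar  : rsym -> nat;
  rdom : forall R : rsym, 'I_(rar R) -> sorts }.

Record structure (L : language) := Structure {
  car  :> sorts L -> Type;
  fint : forall f : fsym L, (forall i, car (fdom (f := f) i)) -> car (fcod f);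
  rint : forall R : rsym L, (forall i, car (rdom (R := R) i)) -> Prop }.

Definition ctx_cons (S V : Type) (s : S) (G : V -> S) : option V -> S :=
  fun o => if o is Some v then G v else s.

Definition ctx_cat (S V W : Type) (G : V -> S) (H : W -> S) : V + W -> S :=
  fun o => match o with inl v => G v | inr w => H w end.

Definition env (L : language) (M : structure L) (V : Type) (G : V -> sorts L) :=
  forall v, M (G v).

Definition env_cons (L : language) (M : structure L) (V : Type)
    (G : V -> sorts L) (s : sorts L) (x : M s) (e : env M G) :
    env M (ctx_cons s G) :=
  fun o => match o with Some v => e v | None => x end.

Definition env_cat (L : language) (M : structure L) (V W : Type)
    (G : V -> sorts L) (H : W -> sorts L) (e : env M G) (e' : env M H) :
    env M (ctx_cat G H) :=
  fun o => match o with inl v => e v | inr w => e' w end.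

Inductive term (L : language) (V : Type) (G : V -> sorts L) : sorts L -> Type :=
| Var (v : V) : term G (G v)
| App (f : fsym L) (args : forall i, term G (fdom (f := f) i)) :
    term G (fcod f).

(* [Bot], [Imp] and [All] are a complete set of connectives classically. *)
Inductive form (L : language) (V : Type) (G : V -> sorts L) : Type :=
| Bot
| Eqn (s : sorts L) (t u : term G s)
| Rel (R : rsym L) (args : forall i, term G (rdom (R := R) i))
| Imp (p q : form G)
| All (s : sorts L) (p : form (ctx_cons s G)).

Fixpoint eval (L : language) (M : structure L) (V : Type) (G : V -> sorts L)
    (e : env M G) (s : sorts L) (t : term G s) : M s :=
  match t with
  | Var v => e v
  | App f args => fint (fun i => eval e (args i))
  end.

Fixpoint sat (L : language) (M : structure L) (V : Type) (G : V -> sorts L)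
    (p : form G) : env M G -> Prop :=
  match p with
  | Bot => fun=> False
  | Eqn s t u => fun e => eval e t = eval e u
  | Rel R args => fun e => rint (fun i => eval e (args i))
  | Imp p q => fun e => sat p e -> sat q e
  | All s p => fun e => forall x : M s, sat p (env_cons x e)
  end.

Fixpoint qfree (L : language) (V : Type) (G : V -> sorts L) (p : form G) : bool :=
  match p with
  | Imp p q => qfree p && qfree q
  | All _ _ => false
  | _ => true
  end.

Definition sentence (L : language) := form (of_void (sorts L)).

Definition holds (L : language) (M : structure L) (p : sentence L) : Prop :=
  sat p (fun v : void => match v return M (of_void _ v) with end).

Definition theory (L : language) := set (sentence L).

Definition models (L : language) (M : structure L) (T : theory L) : Prop :=
  forall p, T p -> holds M p.

Definition tp (L : language) (M : structure L) (V : Type) (G : V -> sorts L)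
    (e : env M G) : set (form G) :=
  [set p | sat p e].

Definition qftp (L : language) (M : structure L) (V : Type) (G : V -> sorts L)
    (e : env M G) : set (form G) :=
  [set p | qfree p /\ sat p e].

(* A formula over [C] is a formula with one extra variable for each element of
   [C]; that variable is always evaluated at the element itself. *)
Definition with_params (L : language) (M : structure L) (s : sorts L) (V : Type)
    (C : set (M s)) (b : V -> M s) : env M (fun _ : V + {c | C c} => s) :=
  fun v => match v with inl v => b v | inr c => sval c end.
Arguments with_params {L M s V} C b _.

Definition tp_over (L : language) (M : structure L) (s : sorts L) (V : Type)
    (C : set (M s)) (b : V -> M s) : set (form (fun _ : V + {c | C c} => s)) :=
  tp (with_params C b).
Arguments tp_over {L M s V} C b _.

Definition algebraic_type (L : language) (M : structure L) (s : sorts L)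
    (V : Type) (C : set (M s)) (p : set (form (fun _ : V + {c | C c} => s))) :=
  exists2 phi, p phi & finite_set [set b : V -> M s | sat phi (with_params C b)].

Definition acl (L : language) (M : structure L) (s : sorts L) (C : set (M s)) :
    set (M s) :=
  [set a | algebraic_type (tp_over C (fun _ : unit => a))].

(* A sort of imaginaries: a 0-definable equivalence relation, modulo T, on a
   finite product of sorts. *)
Record imag (L : language) (T : theory L) := Imag {
  inum : nat;
  ictx : 'I_inum -> sorts L;
  iform : form (ctx_cat ictx ictx);
  iequiv : forall M : structure L, models M T ->
    [/\ forall a : env M ictx, sat iform (env_cat a a),
        forall a b : env M ictx,
          sat iform (env_cat a b) -> sat iform (env_cat b a)
      & forall a b c : env M ictx,
          sat iform (env_cat a b) -> sat iform (env_cat b c) ->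
          sat iform (env_cat a c)] }.

(* The old sorts and symbols, and for each imaginary sort [E] the projection
   from its product of sorts onto [E]. *)
Definition eq_lang (L : language) (T : theory L) : language := {|
  sorts := sorts L + imag T;
  fsym := fsym L + imag T;
  far f := match f with inl f => far f | inr E => inum E end;
  fdom f := match f with
            | inl f => fun i => inl (fdom i)
            | inr E => fun i => inl (ictx i)
            end;
  fcod f := match f with inl f => inl (fcod f) | inr E => inr E end;
  rsym := rsym L;
  rar R := rar R;
  rdom R := fun i => inl (rdom i) |}.

Definition iclass (L : language) (T : theory L) (M : structure L) (E : imag T)
    (a : env M (ictx (i := E))) : set (env M (ictx (i := E))) :=
  [set b | sat (iform E) (env_cat a b)].

Definition eq_car (L : language) (T : theory L) (M : structure L)
    (s : sorts (eq_lang T)) : Type :=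
  match s with
  | inl s => M s
  | inr E => {C : set (env M (ictx (i := E))) | exists a, C = iclass a}
  end.

Definition eq_str (L : language) (T : theory L) (M : structure L) :
    structure (eq_lang T) := {|
  car := eq_car M;
  fint f := match f return
              (forall i, eq_car M (fdom (l := eq_lang T) (f := f) i)) ->
              eq_car M (fcod (l := eq_lang T) f)
            with
            | inl f => fun x => fint (s := M) x
            | inr E => fun x => exist _ (iclass x) (ex_intro _ x erefl)
            end;
  rint R := fun x => rint (s := M) x |}.

Definition eq_theory (L : language) (T : theory L) : theory (eq_lang T) :=
  [set p | forall M : structure L, models M T -> holds (eq_str T M) p].
Arguments eq_theory {L} T _.

Record rsig := RSig { rname :> finType; rarity : rname -> nat }.

Record rstr (sg : rsig) := RStr {
  points :> Type;
  rrel : forall R : sg, set ('I_(rarity R) -> points) }.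

Definition rel_lang (sg : rsig) : language := {|
  sorts := unit;
  fsym := void;
  far := of_void nat;
  fdom := fun f => match f with end;
  fcod := of_void unit;
  rsym := sg;
  rar := @rarity sg;
  rdom := fun _ _ => tt |}.

Definition to_str (sg : rsig) (A : rstr sg) : structure (rel_lang sg) :=
  @Structure (rel_lang sg) (fun=> A)
    (fun f : void => match f with end)
    (fun (R : sg) x => rrel (r := A) (R := R) x).

(* A predicate rather than a [set], for universe reasons. *)
Definition str_class (sg : rsig) := rstr sg -> Prop.

Definition finite_str (sg : rsig) (A : rstr sg) : Prop := finite_set [set: A].

Definition embedding (sg : rsig) (A B : rstr sg) (g : A -> B) : Prop :=
  injective g /\
  forall (R : sg) (x : 'I_(rarity R) -> A), rrel x <-> rrel (g \o x).

Definition isomorphism (sg : rsig) (A B : rstr sg) (g : A -> B) : Prop :=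
  embedding g /\ bijective g.

Definition isomorphic (sg : rsig) (A B : rstr sg) : Prop :=
  exists g : A -> B, isomorphism g.

(* The fixed countably infinite set, from which the domains [B] are taken, is
   [nat]. *)
Definition inF (L : language) (M : structure L) (s : sorts L) (B : {fset nat})
    (f : B -> M s) : Prop :=
  injective f /\
  forall B0 : set B, B0 `<` [set: B] -> ~ algebraic_type (tp_over (f @` B0) f).

Definition phi_sig (N : nat) (ar : 'I_N -> nat) : rsig :=
  {| rname := 'I_N; rarity := ar |}.

Definition phi_str (L : language) (s : sorts L) (N : nat) (ar : 'I_N -> nat)
    (phi : forall i, form (fun _ : 'I_(ar i) => s))
    (M : structure L) (B : {fset nat}) (f : B -> M s) : rstr (phi_sig ar) := {|
  points := B;
  rrel := fun (i : phi_sig ar) => [set x | sat (phi i) (fun j => f (x j))] |}.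

Definition Age (L : language) (T : theory L) (s : sorts L)
    (N : nat) (ar : 'I_N -> nat)
    (phi : forall i, form (fun _ : 'I_(ar i) => s)) : str_class (phi_sig ar) :=
  fun A => exists (M : structure L) (B : {fset nat}) (f : B -> M s),
    [/\ models M T, inF f & isomorphic A (phi_str phi f)].

Definition trianglelefteq (L1 : language) (T1 : theory L1)
    (L2 : language) (T2 : theory L2) : Prop :=
  forall (N : nat) (ar : 'I_N -> nat) (s1 : sorts L1)
         (phi1 : forall i, form (fun _ : 'I_(ar i) => s1)),
  exists (s2 : sorts L2) (phi2 : forall i, form (fun _ : 'I_(ar i) => s2)),
    forall A, Age T1 phi1 A -> Age T2 phi2 A.

Section Fraisse.
Variables (sg : rsig) (K : str_class sg).

(* Closure under isomorphism is the case of a bijective embedding. *)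
Definition HP : Prop :=
  forall (A B : rstr sg) (g : A -> B), K B -> embedding g -> K A.

Definition JEP : Prop :=
  forall A B : rstr sg, K A -> K B ->
  exists (C : rstr sg) (g : A -> C) (h : B -> C),
    [/\ K C, embedding g & embedding h].

Definition AP : Prop :=
  forall (A B C : rstr sg) (g : A -> B) (h : A -> C),
  K A -> K B -> K C -> embedding g -> embedding h ->
  exists (D : rstr sg) (g' : B -> D) (h' : C -> D),
    [/\ K D, embedding g', embedding h' & g' \o g = h' \o h].

Definition fraisse_class : Prop :=
  [/\ forall A, K A -> finite_str A, exists A, K A, HP, JEP & AP].

Definition age_of (M : rstr sg) : str_class sg :=
  fun A => finite_str A /\ exists g : A -> M, embedding g.

Definition ultrahomogeneous (M : rstr sg) : Prop :=
  forall (A : rstr sg) (g h : A -> M),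
  finite_str A -> embedding g -> embedding h ->
  exists2 t : M -> M, isomorphism t & t \o g = h.

Definition generic_model (M : rstr sg) : Prop :=
  [/\ countable [set: M], forall A, K A <-> age_of M A & ultrahomogeneous M].

(* The generic model of a Fraisse class exists and is unique up to
   isomorphism, so this is its complete theory. *)
Definition generic_theory : theory (rel_lang sg) :=
  [set p | exists2 M, generic_model M & holds (to_str M) p].

Definition algebraically_trivial : Prop :=
  forall M : structure (rel_lang sg), models M generic_theory ->
  forall X : set (M tt), acl X = X.

End Fraisse.

Section Product.
Variables (n : nat) (sg : 'I_n -> rsig).

Definition prod_sig : rsig := {|
  rname := {i : 'I_n & sg i};
  rarity := fun R => rarity (tagged R) |}.

Definition prod_str (B : forall i, rstr (sg i)) : rstr prod_sig := {|
  points := forall i, B i;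
  rrel := fun R : prod_sig =>
    [set x : 'I_(rarity (tagged R)) -> forall i, B i
       | rrel (r := B (tag R)) (R := tagged R) (fun j => x j (tag R))] |}.

Definition prod_map (B C : forall i, rstr (sg i)) (g : forall i, B i -> C i) :
    prod_str B -> prod_str C :=
  fun x i => g i (x i).

(* The class of the products [prod_str B], with [K i (B i)] for all [i], is in
   general not hereditary, and since equality of i-th coordinates need not be
   visible in the product language it need not have AP for arbitrary
   embeddings.  It has JEP and AP for coordinatewise embeddings, that is, those
   of the form [prod_map g] with each [g i] an embedding.  Its generic model is
   the countable structure that is a directed union of members of the class and
   is universal and homogeneous for them, all with respect to such
   embeddings. *)
Definition prod_generic_model (K : forall i, str_class (sg i))
    (P : rstr prod_sig) : Prop :=
  exists M : forall i, rstr (sg i),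
  [/\ isomorphic P (prod_str M),
      countable [set: prod_str M],
      forall X : set (prod_str M), finite_set X ->
        exists (B : forall i, rstr (sg i)) (g : forall i, B i -> M i),
          [/\ forall i, K i (B i), forall i, embedding (g i)
            & X `<=` range (prod_map g)],
      forall B : forall i, rstr (sg i), (forall i, K i (B i)) ->
        exists g : forall i, B i -> M i, forall i, embedding (g i)
    & forall (B : forall i, rstr (sg i)) (g h : forall i, B i -> M i),
        (forall i, K i (B i)) ->
        (forall i, embedding (g i)) -> (forall i, embedding (h i)) ->
        exists2 t : forall i, M i -> M i,
          forall i, isomorphism (t i) & prod_map t \o prod_map g = prod_map h].

End Product.

Definition factorization (sg : rsig) (K : str_class sg)
    (n : nat) (sgs : 'I_n -> rsig) (Ks : forall i, str_class (sgs i)) : Prop :=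
  [/\ 1 < n,
      forall i, fraisse_class (Ks i) /\ algebraically_trivial (Ks i)
    & exists (A : rstr sg) (B : rstr (prod_sig sgs)) (u : A -> B),
        [/\ generic_model K A, prod_generic_model Ks B, injective u
          & forall (k : nat) (a a' : 'I_k -> A),
              qftp (M := to_str A) (G := fun=> tt) a =
              qftp (M := to_str A) (G := fun=> tt) a' <->
              tp (M := to_str B) (G := fun=> tt) (u \o a) =
              tp (M := to_str B) (G := fun=> tt) (u \o a')]].

(* One-sorted theories are compared through their T^eq. *)
Definition indecomposable (sg : rsig) (K : str_class sg) : Prop :=
  forall (n : nat) (sgs : 'I_n -> rsig) (Ks : forall i, str_class (sgs i)),
  factorization K Ks ->
  exists i : 'I_n, trianglelefteq (eq_theory (generic_theory K))
                                  (eq_theory (generic_theory (Ks i))).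

Definition hyp_sig (r : nat) : rsig :=
  {| rname := unit; rarity := fun=> r |}.

Definition hypergraphs (r : nat) : str_class (hyp_sig r) :=
  fun A => finite_str A /\
     forall x : 'I_r -> A, rrel (r := A) (R := tt) x ->
       injective x /\ forall p : 'S_r, rrel (r := A) (R := tt) (x \o p).
Arguments hypergraphs r _ : clear implicits.

(* Main.v *)
From mathcomp Require Import finmap all_boot perm.
From mathcomp Require Import boolp classical_sets functions cardinality.
Require Import Defs.

(** Hypergraphs are amalgamated freely, which gives [hypergraphs_fraisse].  Their
    generic model is realized on the natural numbers ([generic_hyp]): a set is an
    edge when its largest element codes the set of the others, so that finite
    pieces can always be extended by one point, and back-and-forth does the rest.
    Algebraic closure is trivial because any point a can be copied over a finite
    set: the copy gets the edges of a, and no edge contains both ([clone]).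

    For indecomposability, let A be the generic hypergraph and u an injection of A
    into a product of generic models M i such that the type of u a in the product
    determines and is determined by the quantifier-free type of a.  The proof finds
    a coordinate i for which the map v taking c to u c i reflects quantifier-free
    types, and then shows that such a map always yields the relation between the
    theories.

    The coordinate ([separating_factor]).  Relations of the i-th factor are visible
    in the product, but equality of i-th coordinates is not.  Its definable
    substitute is indiscernibility by the relations of that factor; through u it
    becomes an invariant equivalence relation on A, and as any two points of A have
    a common neighbour of each kind, it is either equality or total
    ([indisc_dichotomy]).  Take an edge a and a non-edge a' that differ in one
    entry.  If no factor with trivial indiscernibility separated u a from u a', an
    automorphism in each of these factors followed by the exchange of two points
    indiscernible at all factors would carry u a to u a', so that a and a' would
    have the same type.  So at some i the map v is injective and a relation R of
    M i separates u a from u a'.  An injective r-tuple has only two possible types,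
    hence R tells edges from non-edges everywhere.

    The transfer ([transfer_trianglelefteq]).  Let v map the generic model A of K to
    the generic model N of K', reflecting quantifier-free types.  By back-and-forth
    in all sorts ([sat_lifts]) the truth of a formula at imaginaries depends only on
    the quantifier-free type of tuples of points that represent them.  Elements of
    an imaginary sort of K can therefore be coded in K' by the tuples v y of N, for y
    a representative in A, and formulas translate to disjunctions of
    quantifier-free types.  It remains to make the coded family algebraically
    independent; for that each code gets one more coordinate, chosen fresh, which
    the translated formulas ignore.  As algebraic closure is trivial in K', fresh
    points have infinitely many conjugates over everything else. *)

Set Implicit Arguments.
Unset Strict Implicit.
Unset Printing Implicit Defensive.

Local Open Scope classical_set_scope.

Local Notation funextd := functional_extensionality_dep.

(** * Definable relations *)

(** Sorts are indices of types, so changing a sort along an equality moves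
    elements by a cast. *)
Definition tr (L : language) (M : structure L) (s s' : sorts L) (h : s = s')
  (x : M s) : M s' := eq_rect s (car M) x s' h.

Lemma tr_id (L : language) (M : structure L) (s : sorts L) (h : s = s)
  (x : M s) : tr h x = x.
Proof. by rewrite (Prop_irrelevance h erefl). Qed.

Lemma tr_trans (L : language) (M : structure L) (s1 s2 s3 : sorts L)
  (h : s1 = s2) (h' : s2 = s3) (x : M s1) :
  tr h' (tr h x) = tr (etrans h h') x.
Proof. by case: s3 / h'; case: s2 / h. Qed.

Definition pull (L : language) (M : structure L) (V W : Type)
    (S : V -> sorts L) (H : W -> sorts L) (f : V -> W)
    (h : forall v, H (f v) = S v) (e : env M H) : env M S :=
  fun v => tr (h v) (e (f v)).

(** [P] is definable when it is given by a formula in every context [H] that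
    contains, through [f], variables of the sorts prescribed by [S].  Leaving the
    context free makes the notion stable under weakening and renaming by
    definition, without an operation of substitution on formulas; sentences about
    tuples are then obtained by composing closure properties. *)
Definition definable (L : language) (V : Type) (S : V -> sorts L)
    (P : forall M : structure L, env M S -> Prop) : Prop :=
  forall (W : Type) (H : W -> sorts L) (f : V -> W)
    (h : forall v, H (f v) = S v),
  exists p : form H, forall (M : structure L) (e : env M H),
    sat p e <-> P M (pull h e).

Definition term_definable (L : language) (V : Type) (S : V -> sorts L)
    (s : sorts L) (F : forall M : structure L, env M S -> M s) : Prop :=
  forall (W : Type) (H : W -> sorts L) (f : V -> W)
    (h : forall v, H (f v) = S v),
  exists t : term H s, forall (M : structure L) (e : env M H),
    eval e t = F M (pull h e).

Section Definable.
Variable L : language.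

Lemma def_ext V (S : V -> sorts L) (P Q : forall M : structure L, env M S -> Prop) :
  (forall M e, P M e <-> Q M e) -> definable P -> definable Q.
Proof.
move=> PQ dP W H f h; have [p pP] := dP W H f h.
by exists p => M e; rewrite pP PQ.
Qed.

Lemma def_form V (S : V -> sorts L) (P : forall M : structure L, env M S -> Prop) :
  definable P -> exists p : form S, forall M e, sat p e <-> P M e.
Proof.
by move=> /(_ V S id (fun=> erefl)) [p pP]; exists p => M e; rewrite pP.
Qed.

Lemma def_sentence (P : structure L -> Prop) :
  @definable L void (of_void _) (fun M _ => P M) ->
  exists p : sentence L, forall M, holds M p <-> P M.
Proof. by move=> /def_form [p pP]; exists p => M; rewrite /holds pP. Qed.

Lemma def_bot V (S : V -> sorts L) :
  definable (fun (M : structure L) (_ : env M S) => False).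
Proof. by move=> W H f h; exists (Bot H). Qed.

Lemma def_imp V (S : V -> sorts L) (P Q : forall M : structure L, env M S -> Prop) :
  definable P -> definable Q -> definable (fun M e => P M e -> Q M e).
Proof.
move=> dP dQ W H f h; have [p pP] := dP W H f h; have [q qQ] := dQ W H f h.
by exists (Imp p q) => M e /=; rewrite pP qQ.
Qed.

Lemma def_not V (S : V -> sorts L) (P : forall M : structure L, env M S -> Prop) :
  definable P -> definable (fun M e => ~ P M e).
Proof. by move=> dP; apply: def_imp => //; exact: def_bot. Qed.

Lemma def_and V (S : V -> sorts L) (P Q : forall M : structure L, env M S -> Prop) :
  definable P -> definable Q -> definable (fun M e => P M e /\ Q M e).
Proof.
move=> dP dQ; apply: (def_ext (P := fun M e => ~ (P M e -> ~ Q M e))).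
  by move=> M e; split=> [/not_implyP[? /contrapT]|[p q] /(_ p)].
by apply: def_not; apply: def_imp => //; exact: def_not.
Qed.

Lemma def_iff V (S : V -> sorts L) (P Q : forall M : structure L, env M S -> Prop) :
  definable P -> definable Q -> definable (fun M e => P M e <-> Q M e).
Proof. by move=> dP dQ; apply: def_and; apply: def_imp. Qed.

Lemma def_const V (S : V -> sorts L) (b : Prop) :
  definable (fun (M : structure L) (_ : env M S) => b).
Proof.
case: (pselect b) => hb; last first.
  by apply: def_ext (@def_bot V S) => M e; tauto.
by apply: def_ext (def_not (@def_bot V S)) => M e; tauto.
Qed.

Lemma def_all V (S : V -> sorts L) s
    (P : forall M : structure L, env M S -> M s -> Prop) :
  @definable L (option V) (ctx_cons s S)
    (fun M e => P M (fun v => e (Some v)) (e None)) ->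
  definable (fun M e => forall x : M s, P M e x).
Proof.
move=> dP W H f h.
pose h' (o : option V) : ctx_cons s H (omap f o) = ctx_cons s S o :=
  match o with Some v => h v | None => erefl end.
have [p pP] := dP (option W) (ctx_cons s H) (omap f) h'.
exists (All p) => M e /=; split=> hp x; have := hp x.
  by move=> /pP.
by move=> hx; apply/pP.
Qed.

Lemma def_ex V (S : V -> sorts L) s
    (P : forall M : structure L, env M S -> M s -> Prop) :
  @definable L (option V) (ctx_cons s S)
    (fun M e => P M (fun v => e (Some v)) (e None)) ->
  definable (fun M e => exists x : M s, P M e x).
Proof.
move=> dP; apply: (def_ext (P := fun M e => ~ (forall x, ~ P M e x))).
  by move=> M e; rewrite forallNE notK.
by apply: def_not; apply: (def_all (P := fun M e x => ~ P M e x)); apply: def_not.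
Qed.

Lemma def_ren V V' (S : V -> sorts L) (S' : V' -> sorts L) (f : V -> V')
    (h : forall v, S' (f v) = S v) (P : forall M : structure L, env M S -> Prop) :
  definable P -> definable (fun M e => P M (pull h e)).
Proof.
move=> dP W H g k.
have [p pP] := dP W H (g \o f) (fun v => etrans (k (f v)) (h v)).
exists p => M e; rewrite pP; suff -> : pull (fun v => etrans (k (f v)) (h v)) e
  = pull h (pull k e) by [].
by apply: funextd => v; rewrite /pull tr_trans.
Qed.

Lemma def_forallfin V (S : V -> sorts L) (T : finType)
    (P : T -> forall M : structure L, env M S -> Prop) :
  (forall t, definable (P t)) -> definable (fun M e => forall t, P t M e).
Proof.
move=> dP; suff /(_ (enum T)) : forall s : seq T,
    definable (fun (M : structure L) (e : env M S) => forall t, t \in s -> P t M e).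
  apply: def_ext => M e; split=> [hP t|hP t _]; last exact: hP.
  by apply: hP; rewrite mem_enum.
elim=> [|t s IH].
  by apply: def_ext (@def_const V S True) => M e; split.
apply: def_ext (def_and (dP t) IH) => M e; split.
  by move=> [ht hs] t'; rewrite inE => /orP[/eqP ->|/hs].
by move=> hP; split=> [|t' t's]; apply: hP; rewrite inE ?eqxx // t's orbT.
Qed.

Lemma def_existsfin V (S : V -> sorts L) (T : finType)
    (P : T -> forall M : structure L, env M S -> Prop) :
  (forall t, definable (P t)) -> definable (fun M e => exists t, P t M e).
Proof.
move=> dP; apply: (def_ext (P := fun M e => ~ (forall x, ~ P x M e))).
  by move=> M e; rewrite forallNE notK.
by apply: def_not; apply: def_forallfin => t; exact: def_not.
Qed.

(** A property that depends only on the truth values of finitely many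
    definable ones is the disjunction over the favourable rows of its truth
    table. *)
Lemma def_fintype V (S : V -> sorts L) (T : finType)
    (a : T -> forall M : structure L, env M S -> Prop)
    (P : forall M : structure L, env M S -> Prop) :
  (forall t, definable (a t)) ->
  (forall M e M' e', (forall t, a t M e <-> a t M' e') -> P M e -> P M' e') ->
  definable P.
Proof.
move=> da Pa; pose good (b : {ffun T -> bool}) :=
  exists M e, P M e /\ forall t, a t M e <-> b t.
apply: (def_ext (P := fun M e => exists b : {ffun T -> bool},
    good b /\ forall t, a t M e <-> b t)); last first.
  apply: def_existsfin => b; apply: def_and; first exact: def_const.
  by apply: def_forallfin => t; apply: def_iff => //; exact: def_const.
move=> M e; split=> [[b [[M' [e' [Pe' ab']]] ab]]|Pe].
  by apply: Pa Pe' => t; rewrite ab ab'.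
have ab t : a t M e <-> [ffun t => `[< a t M e >]] t.
  by rewrite ffunE; split=> /asboolP.
by exists [ffun t => `[< a t M e >]]; split=> //; exists M, e.
Qed.

(** By induction on [k]: the first of the [k] quantifiers is absorbed into the
    context as its [None] variable. *)
Lemma def_alls_ord k : forall V (S : V -> sorts L) s
    (P : forall M : structure L, env M S -> ('I_k -> M s) -> Prop),
  @definable L (V + 'I_k) (ctx_cat S (fun=> s))
    (fun M e => P M (fun v => e (inl v)) (fun i => e (inr i))) ->
  definable (fun M e => forall z : 'I_k -> M s, P M e z).
Proof.
elim: k => [|k IH] V S s P dP.
  pose f (v : V + 'I_0) : V := match v with inl v => v
    | inr i => False_rect V (notF (ltn_ord i)) end.
  have h v : S (f v) = ctx_cat S (fun=> s) v by case: v => [v|[]].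
  apply: def_ext (def_ren h dP) => M e /=.
  have -> : (fun v => pull h e (inl v)) = e.
    by apply: funextd => v; rewrite /pull tr_id.
  have -> : (fun i => pull h e (inr i)) =
      (fun i : 'I_0 => False_rect _ (notF (ltn_ord i))).
    by apply: funextd => -[].
  split=> [hP z|]; last exact.
  suff -> : z = (fun i => False_rect _ (notF (ltn_ord i))) by [].
  by apply: funextd => -[].
pose f (v : V + 'I_k.+1) : option V + 'I_k := match v with
  | inl v => inl (Some v)
  | inr i => if unlift ord0 i is Some j then inr j else inl None end.
have h v : ctx_cat (ctx_cons s S) (fun=> s) (f v) = ctx_cat S (fun=> s) v.
  by case: v => //= i; case: (unlift ord0 i).
have hE M (e : env M S) x (z : 'I_k -> M s) :
    let e' := pull h (env_cat (env_cons x e) z) in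
    (fun v => e' (inl v)) = e /\
    (fun i => e' (inr i)) = (fun i => oapp z x (unlift ord0 i)).
  split.
    by apply: funextd => v; rewrite /pull tr_id.
  apply: funextd => i; rewrite /pull; move: (h (inr i)); rewrite /f /=.
  by case: (unlift ord0 i) => [j|] hj; rewrite tr_id.
have dQ := def_ren h dP.
have {}dQ := IH (option V) (ctx_cons s S) s
  (fun M e z => P M (fun v => e (Some v)) (fun i => oapp z (e None) (unlift ord0 i))).
have {}dQ : definable (S := S)
    (fun M e => forall x z, P M e (fun i => oapp z x (unlift ord0 i))).
  apply: def_all; apply: dQ; apply: def_ext (def_ren h dP) => M e.
  have -> : e = env_cat (env_cons (e (inl None)) (fun v => e (inl (Some v))))
                        (fun i => e (inr i)).
    by apply: funextd => -[[v|]|i].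
  by have [-> ->] := hE M (fun v => e (inl (Some v))) (e (inl None))
                        (fun i => e (inr i)).
apply: def_ext dQ => M e; split=> hP; last by move=> x z; exact: hP.
move=> z; have := hP (z ord0) (fun j => z (lift ord0 j)).
suff -> : (fun i => oapp (fun j => z (lift ord0 j)) (z ord0) (unlift ord0 i)) = z by [].
by apply: funextd => i; case: unliftP => [j|] ->.
Qed.

Lemma def_alls V (S : V -> sorts L) s (J : finType)
    (P : forall M : structure L, env M S -> (J -> M s) -> Prop) :
  @definable L (V + J) (ctx_cat S (fun=> s))
    (fun M e => P M (fun v => e (inl v)) (fun i => e (inr i))) ->
  definable (fun M e => forall z : J -> M s, P M e z).
Proof.
move=> dP.
pose f (v : V + J) : V + 'I_#|J| := match v with inl v => inl v
  | inr j => inr (enum_rank j) end.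
have h v : ctx_cat S (fun=> s) (f v) = ctx_cat S (fun=> s) v by case: v.
have dQ := @def_alls_ord #|J| V S s (fun M e z => P M e (z \o enum_rank)).
have {}dQ : definable (S := S)
    (fun M e => forall z : 'I_#|J| -> M s, P M e (z \o enum_rank)).
  apply: dQ; apply: def_ext (def_ren h dP) => M e.
  have -> : (fun v => pull h e (inl v)) = (fun v => e (inl v)).
    by apply: funextd => v; rewrite /pull tr_id.
  by have -> : (fun v => pull h e (inr v)) = (fun j => e (inr (enum_rank j)));
    first by apply: funextd => v; rewrite /pull tr_id.
apply: def_ext dQ => M e; split=> hP z; last exact: hP.
have := hP (z \o enum_val).
suff -> : (z \o enum_val) \o enum_rank = z by [].
by apply: funextd => i /=; rewrite enum_rankK.
Qed.

Lemma def_exs V (S : V -> sorts L) s (J : finType)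
    (P : forall M : structure L, env M S -> (J -> M s) -> Prop) :
  @definable L (V + J) (ctx_cat S (fun=> s))
    (fun M e => P M (fun v => e (inl v)) (fun i => e (inr i))) ->
  definable (fun M e => exists z : J -> M s, P M e z).
Proof.
move=> dP; apply: (def_ext (P := fun M e => ~ (forall x, ~ P M e x))).
  by move=> M e; rewrite forallNE notK.
by apply: def_not; apply: (def_alls (P := fun M e x => ~ P M e x)); apply: def_not.
Qed.

Lemma tdef_var V (S : V -> sorts L) (v : V) s (hv : S v = s) :
  term_definable (fun (M : structure L) (e : env M S) => tr hv (e v)).
Proof.
move=> W H f h; case: s / hv.
exists (eq_rect _ (term H) (Var H (f v)) _ (h v)) => M e; rewrite /pull /=.
by case: _ / (h v).
Qed.

Lemma tdef_id V (S : V -> sorts L) (v : V) :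
  term_definable (fun (M : structure L) (e : env M S) => e v).
Proof. exact: tdef_var erefl. Qed.

Lemma tdef_app V (S : V -> sorts L) (f : fsym L)
    (F : forall i, forall M : structure L, env M S -> M (fdom (f := f) i)) :
  (forall i, term_definable (F i)) ->
  term_definable (fun M e => fint (fun i => F i M e)).
Proof.
move=> dF W H g h.
have /cid : exists t : (forall i, term H (fdom (f := f) i)),
    forall i (M : structure L) (e : env M H), eval e (t i) = F i M (pull h e).
  have d i := cid (dF i W H g h).
  by exists (fun i => sval (d i)) => i; exact: (svalP (d i)).
move=> [t tE]; exists (App t) => M e /=; congr fint.
by apply: funextd => i.
Qed.

Lemma def_eq V (S : V -> sorts L) s
    (F G : forall M : structure L, env M S -> M s) :
  term_definable F -> term_definable G -> definable (fun M e => F M e = G M e).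
Proof.
move=> dF dG W H f h; have [t tE] := dF W H f h; have [u uE] := dG W H f h.
by exists (Eqn t u) => M e /=; rewrite tE uE.
Qed.

Lemma def_rel V (S : V -> sorts L) (R : rsym L)
    (F : forall i, forall M : structure L, env M S -> M (rdom (R := R) i)) :
  (forall i, term_definable (F i)) ->
  definable (fun M e => rint (fun i => F i M e)).
Proof.
move=> dF W H g h.
have d i := cid (dF i W H g h).
exists (Rel (fun i => sval (d i))) => M e /=.
suff -> : (fun i => eval e (sval (d i))) = (fun i => F i M (pull h e)) by [].
by apply: funextd => i; exact: (svalP (d i)).
Qed.

End Definable.

(** * Back-and-forth between relational structures *)

(** The type [unit] of sorts of a relational language is not definitionally a
    singleton, so the value of a variable of sort [u] has to be moved to [M tt]. *)
Definition cell (sg : rsig) (M : structure (rel_lang sg)) (u : unit) :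
  M u -> M tt := match u with tt => id end.

Definition flat (sg : rsig) (M : structure (rel_lang sg)) (V : Type)
  (G : V -> unit) (e : env M G) : V -> M tt := fun v => cell (e v).

(** A partial isomorphism, as its graph.  Graphs make restrictions and unions of
    chains immediate, and do not depend on an enumeration of the domain. *)
Definition piso (sg : rsig) (M M' : structure (rel_lang sg))
    (P : set (M tt * M' tt)) : Prop :=
  (forall p q, P p -> P q -> (p.1 = q.1 <-> p.2 = q.2)) /\
  forall (R : sg) (w : 'I_(rarity R) -> M tt * M' tt), (forall i, P (w i)) ->
    (rint (s := M) (R := R : rsym (rel_lang sg)) (fun i => (w i).1) <->
     rint (s := M') (R := R : rsym (rel_lang sg)) (fun i => (w i).2)).

(** The family F need not contain all partial isomorphisms: graphs that are part
    of an isomorphism are another useful choice. *)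
Definition back_and_forth (sg : rsig) (M M' : structure (rel_lang sg))
    (F : set (set (M tt * M' tt))) : Prop :=
  forall P, F P ->
  [/\ piso P,
      forall x, exists x' Q, [/\ F Q, P `<=` Q & Q (x, x')]
    & forall x', exists x Q, [/\ F Q, P `<=` Q & Q (x, x')]].

Section BackAndForth.
Variable sg : rsig.
Implicit Types M N : structure (rel_lang sg).

Lemma cell_inj M u : injective (@cell sg M u).
Proof. by case: u. Qed.

Lemma term_var V (G : V -> unit) (s : unit) (t : term (L := rel_lang sg) G s) :
  exists v, forall M (e : env M G), cell (eval e t) = flat e v.
Proof. by case: t => [v|[]]; exists v. Qed.

Lemma piso_sub M N (P Q : set (M tt * N tt)) : P `<=` Q -> piso Q -> piso P.
Proof.
move=> PQ [eqQ relQ]; split; first by move=> p q /PQ Qp /PQ Qq; exact: eqQ.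
by move=> R w Pw; apply: relQ => i; exact/PQ.
Qed.

(** A formula has finitely many free variables, here collected in X; environments
    that a member of F matches on X satisfy it together, by the usual induction.
    The bound variable of a quantifier is matched by one extension step. *)
Lemma sat_back_and_forth M N (F : set (set (M tt * N tt))) :
  back_and_forth F ->
  forall V (G : V -> unit) (p : form (L := rel_lang sg) G),
  exists X : set V, finite_set X /\
    forall P (e : env M G) (e' : env N G), F P ->
      (forall v, X v -> P (flat e v, flat e' v)) -> (sat p e <-> sat p e').
Proof.
move=> bfF V G p; elim: p => {V G} [V G|V G s t u|V G R args|V G p IHp q IHq|V G s p IH].
- by exists set0; split; first exact: finite_set0.
- have [v vE] := term_var t; have [w wE] := term_var u.
  exists [set v; w]; split; first exact: finite_set2.
  move=> P e e' FP Pe /=; have [[eqP _] _ _] := bfF _ FP.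
  have := eqP _ _ (Pe v (or_introl erefl)) (Pe w (or_intror erefl)); rewrite /= -!vE -!wE.
  by move=> [h1 h2]; split=> [h|h]; apply: cell_inj; [apply: h1|apply: h2]; rewrite h.
- have /cid[f fE] : exists f : 'I_(rarity R) -> V, forall i M (e : env M G),
      eval e (args i) = flat e (f i).
    have v i := cid (term_var (args i)).
    by exists (fun i => sval (v i)) => i; exact: (svalP (v i)).
  exists (range f); split; first exact/finite_image/finite_finset.
  move=> P e e' FP Pe /=; have [[_ relP] _ _] := bfF _ FP.
  have /= := relP R (fun i => (flat e (f i), flat e' (f i))).
  have -> : (fun i => flat e (f i)) = (fun i => eval e (args i)).
    by apply: funextd => i; rewrite -fE.
  have -> : (fun i => flat e' (f i)) = (fun i => eval e' (args i)).
    by apply: funextd => i; rewrite -fE.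
  by apply=> i; apply: Pe; exists i.
- have [X [finX hX]] := IHp; have [Y [finY hY]] := IHq.
  exists (X `|` Y); split; first by rewrite finite_setU.
  move=> P e e' FP Pe /=; rewrite (hX P e e') // ?(hY P e e') //.
    by move=> v Yv; apply: Pe; right.
  by move=> v Xv; apply: Pe; left.
have [X [finX hX]] := IH; exists (Some @^-1` X); split.
  by apply: finite_preimage => // x y _ _ [].
case: s p {IH} hX => p hX P e e' FP Pe /=; have [_ forth back] := bfF _ FP; split=> hp x.
  have [x' [Q [FQ PQ Qx]]] := back x; apply/(hX Q (env_cons x' e)); last exact: hp.
    exact: FQ.
  by case=> [v|] Xv; [exact/PQ/Pe|exact: Qx].
have [x' [Q [FQ PQ Qx]]] := forth x; apply/(hX Q _ (env_cons x' e')); last exact: hp.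
  exact: FQ.
by case=> [v|] Xv; [exact/PQ/Pe|exact: Qx].
Qed.

End BackAndForth.

(** * Generic models and models of their theories *)

Lemma finite_range (T : Type) (X : set T) :
  finite_set X -> exists n (f : 'I_n -> T), X = range f.
Proof.
move=> finX; have /finite_seqP[s ->] : finite_set (X : set {classic T}) by [].
exists (size s), (tnth (in_tuple s)); apply/seteqP; split=> x /=.
  move=> /(nthP (x : {classic T}))[i lti <-].
  by exists (Ordinal lti); rewrite // (tnth_nth x).
by move=> [i _ <-]; exact: mem_tnth.
Qed.

Lemma sval_inj (T : Type) (X : set T) : injective (@sval T X).
Proof. by move=> [x Xx] [y Xy] /= exy; exact: eq_exist. Qed.

Definition sub_rstr (sg : rsig) (A : rstr sg) (X : set A) : rstr sg :=
  {| points := {x : A | X x};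
     rrel := fun R (x : 'I_(rarity R) -> {x : A | X x}) =>
       rrel (fun i => sval (x i)) |}.

Section Pisos.
Variable sg : rsig.
Implicit Types A B C : rstr sg.
Implicit Types M N : structure (rel_lang sg).

Lemma sub_emb A (X : set A) : embedding (A := sub_rstr X) (B := A) sval.
Proof. by split; first exact: sval_inj. Qed.

Lemma sub_finite A (X : set A) : finite_set X -> finite_str (sub_rstr X).
Proof.
move=> finX; rewrite /finite_str.
have -> : [set: sub_rstr X] = (@sval A X) @^-1` X.
  by apply/seteqP; split=> // -[].
by apply: finite_preimage => // x y _ _; exact: sval_inj.
Qed.

Lemma emb_piso A B (g : A -> B) : embedding g ->
  piso (M := to_str A) (M' := to_str B) [set p | g p.1 = p.2].
Proof.
move=> [injg relg]; split.
  by move=> p q /= <- <-; split=> [->|/injg].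
move=> R w gw /=; rewrite (relg R (fun i => (w i).1)).
by have -> : g \o (fun i => (w i).1) = (fun i => (w i).2) by apply: funextd.
Qed.

Lemma piso_preimage A B A' B' (f : A -> A') (g : B -> B') (P : set (A' * B')) :
  embedding f -> embedding g -> piso (M := to_str A') (M' := to_str B') P ->
  piso (M := to_str A) (M' := to_str B) [set p | P (f p.1, g p.2)].
Proof.
move=> [injf relf] [injg relg] [eqP relP]; split.
  move=> p q /= Pp Pq; have /= [h1 h2] := eqP _ _ Pp Pq.
  by split=> [e|e]; [apply/injg/h1|apply/injf/h2]; rewrite e.
move=> R w Pw /=; rewrite relf relg.
exact: (relP R (fun i => (f (w i).1, g (w i).2))).
Qed.

Lemma piso_image A B A' B' (f : A -> A') (g : B -> B') (P : set (A * B)) :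
  embedding f -> embedding g -> piso (M := to_str A) (M' := to_str B) P ->
  piso (M := to_str A') (M' := to_str B') ((fun p => (f p.1, g p.2)) @` P).
Proof.
move=> [injf relf] [injg relg] [eqP relP]; split.
  move=> p q /= [p' Pp <-] [q' Pq <-] /=; have [h1 h2] := eqP _ _ Pp Pq.
  by split=> [/injf/h1 ->|/injg/h2 ->].
move=> R w Pw /=.
have /choice[w' w'P] i : exists p, P p /\ (f p.1, g p.2) = w i.
  by have [p Pp <-] := Pw i; exists p.
have /= := relP R w' (fun i => (w'P i).1).
rewrite relf relg.
by have -> : w = (fun i => (f (w' i).1, g (w' i).2))
  by apply: funextd => i; have [_ ->] := w'P i.
Qed.

Lemma piso_swap M N (P : set (M tt * N tt)) :
  piso P -> piso [set p | P (p.2, p.1)].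
Proof.
move=> [eqP relP]; split; first by move=> p q /= Pp Pq; have /= := eqP _ _ Pp Pq; tauto.
by move=> R w Pw; have /= := relP R (fun i => ((w i).2, (w i).1)) Pw; tauto.
Qed.

Lemma finite_swap (T U : Type) (P : set (T * U)) :
  finite_set P -> finite_set [set p | P (p.2, p.1)].
Proof.
move=> finP; have -> : [set p | P (p.2, p.1)] = (fun p => (p.2, p.1)) @^-1` P by [].
by apply: finite_preimage => // -[x y] [x' y'] _ _ /= [-> ->].
Qed.

Definition finpiso M N : set (set (M tt * N tt)) :=
  [set P | finite_set P /\ piso P].

(** One half of the back-and-forth property for all finite partial isomorphisms;
    it is proved separately in each direction. *)
Definition extendable M N : Prop :=
  forall P : set (M tt * N tt), finite_set P -> piso P ->
  forall x, exists x', piso (P `|` [set (x, x')]).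

Lemma extendable_back_and_forth M N :
  extendable M N -> extendable N M -> back_and_forth (@finpiso M N).
Proof.
move=> eMN eNM P [finP pisoP]; split=> // x.
  have [x' px'] := eMN P finP pisoP x; exists x', (P `|` [set (x, x')]).
  split; [split=> //|by move=> p; left|by right].
  by rewrite finite_setU; split=> //; exact: finite_set1.
have [x' px'] := eNM _ (finite_swap finP) (piso_swap pisoP) x.
exists x', (P `|` [set (x', x)]); split; [split|by move=> p; left|by right].
  by rewrite finite_setU; split=> //; exact: finite_set1.
apply: piso_sub (piso_swap px') => -[y z] [|] /=; first by left.
by move=> [-> ->]; right.
Qed.

Lemma extendable_tuple M N (J : finType) (P : set (M tt * N tt)) (y : J -> M tt) :
  extendable M N -> finite_set P -> piso P ->
  exists y' : J -> N tt, let Q := P `|` range (fun j => (y j, y' j)) in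
    finite_set Q /\ piso Q.
Proof.
move=> eMN finP pisoP.
have [Q [PQ [finQ pisoQ] Qy]] : exists Q, [/\ P `<=` Q, finite_set Q /\ piso Q
    & forall j, j \in enum J -> exists x', Q (y j, x')].
  elim: (enum J) => [|j s [Q [PQ [finQ pisoQ] Qy]]].
    by exists P; split=> // j; rewrite in_nil.
  have [x' px'] := eMN Q finQ pisoQ (y j); exists (Q `|` [set (y j, x')]); split.
  - by move=> p Pp; left; exact: PQ.
  - by split=> //; rewrite finite_setU; split=> //; exact: finite_set1.
  move=> i; rewrite inE => /orP[/eqP->|/Qy[z Qz]]; last by exists z; left.
  by exists x'; right.
have /choice[y' Qy'] : forall j, exists x', Q (y j, x').
  by move=> j; apply: Qy; rewrite mem_enum.
exists y' => /=; have sQ : P `|` range (fun j => (y j, y' j)) `<=` Q.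
  by move=> p [/PQ //|[j _ <-]].
by split; [exact: sub_finite_set finQ|exact: piso_sub pisoQ].
Qed.

(** The parts of the graph of an isomorphism form a back-and-forth system. *)
Lemma sat_iso A B (g : A -> B) : isomorphism g ->
  forall V (p : form (L := rel_lang sg) (fun _ : V => tt)) (e : V -> A),
  sat (M := to_str A) p e <-> sat (M := to_str B) p (g \o e).
Proof.
move=> [embg [g' gK g'K]] V p e.
have bf : back_and_forth
    [set P | P `<=` [set p : to_str A tt * to_str B tt | g p.1 = p.2]].
  move=> P Pg; split; first exact: piso_sub (emb_piso embg).
    move=> x; exists (g x), (P `|` [set (x, g x)]); split; [|by left|by right].
    by move=> q [/Pg //|->].
  move=> x; exists (g' x), (P `|` [set (g' x, x)]); split; [|by left|by right].
  by move=> q [/Pg //|-> /=].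
have [X [_ hX]] := sat_back_and_forth bf p.
by apply: (hX (range (fun v => (e v, g (e v))))) => [q [v _ <-] //|v _]; exists v.
Qed.

Section Generic.
Variable K : str_class sg.

(** Ultrahomogeneity in terms of graphs: the domain of P is a finite substructure
    with two embeddings, the inclusion and P itself. *)
Lemma piso_aut A (P : set (A * A)) : ultrahomogeneous A ->
  finite_set P -> piso (M := to_str A) (M' := to_str A) P ->
  exists2 t : A -> A, isomorphism t & forall p, P p -> t p.1 = p.2.
Proof.
move=> homA finP [eqP relP].
have /choice[h hP] : forall x : sub_rstr [set p.1 | p in P], exists y, P (sval x, y).
  by move=> [x [[x' y] /= Pxy <-]]; exists y.
have finX : finite_set [set p.1 | p in P] by exact: finite_image.
have embh : embedding h.
  split; first by move=> x y exy; apply: sval_inj; apply/(eqP _ _ (hP x) (hP y)).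
  by move=> R x; exact: (relP R (fun i => (sval (x i), h (x i)))).
have [t isot th] := homA _ _ _ (sub_finite finX) (sub_emb _) embh.
exists t => // p Pp.
have p1 : [set p.1 | p in P] p.1 by exists p.
have -> : t p.1 = h (exist _ p.1 p1) by rewrite -th.
by apply/(eqP (p.1, h (exist _ p.1 p1)) p) => //; exact: hP (exist _ p.1 p1).
Qed.

(** Embed B in A by universality, then correct the embedding by an automorphism so
    that it extends P. *)
Lemma generic_ext A B (P : set (B * A)) (x : B) : generic_model K A -> K B ->
  finite_set P -> piso (M := to_str B) (M' := to_str A) P ->
  exists x', piso (M := to_str B) (M' := to_str A) (P `|` [set (x, x')]).
Proof.
move=> [_ ageA homA] /ageA[finB [k embk]] finP pisoP.
have embid : embedding (@idfun A) by split.
have [t isot tP] := piso_aut homA (finite_image _ finP) (piso_image embk embid pisoP).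
have embtk : embedding (t \o k).
  by case: isot embk => -[it rt] _ [ik rk]; split=> [|R z];
    [exact: inj_comp|rewrite rk rt].
exists (t (k x)); apply: piso_sub (emb_piso embtk) => p [Pp|->] //=.
by apply: (tP (k p.1, p.2)); exists p.
Qed.

Lemma generic_extendable A A' : generic_model K A -> generic_model K A' ->
  extendable (to_str A) (to_str A').
Proof.
move=> gA gA' P finP pisoP x.
pose X := [set p.1 | p in P] `|` [set x].
have finX : finite_set X.
  by rewrite finite_setU; split; [exact: finite_image|exact: finite_set1].
have KX : K (sub_rstr X).
  case: gA => _ ageA _; apply/ageA; split; first exact: sub_finite.
  by exists sval; exact: sub_emb.
have embid : embedding (@idfun A') by split.
pose P' := [set p : sub_rstr X * A' | P (sval p.1, p.2)].
have finP' : finite_set P'.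
  have -> : P' = (fun p => (sval p.1, p.2)) @^-1` P by [].
  by apply: finite_preimage => // -[u v] [u' v'] _ _ /= [/sval_inj -> ->].
have Xx : X x by right.
have [x' px'] := generic_ext (exist _ x Xx : sub_rstr X) gA' KX finP'
  (piso_preimage (sub_emb X) embid pisoP).
exists x'; apply: piso_sub (piso_image (sub_emb X) embid px') => -[y y'] [Py|->].
  have Xy : X y by left; exists (y, y').
  by exists (exist _ y Xy, y') => //; left.
by exists (exist _ x Xx, x') => //; right.
Qed.

Lemma generic_piso0 A A' : generic_model K A -> generic_model K A' ->
  piso (M := to_str A) (M' := to_str A') set0.
Proof.
move=> [_ ageA _] [_ ageA' _].
have /ageA/ageA'[_ [k embk]] : age_of A (sub_rstr (set0 : set A)).
  by split; [exact/sub_finite/finite_set0|exists sval; exact: sub_emb].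
apply: piso_sub (piso_image (sub_emb set0) embk (P := set0) _) => //.
split=> // R w w0; have nr (i : 'I_(rarity R)) : False := w0 i.
have no_index T (z z' : 'I_(rarity R) -> T) : z = z'.
  by apply: funextd => i; case: (nr i).
by rewrite /= (no_index _ (fun i => sval (w i).1) (fun i => sval (w i).2)).
Qed.

(** The theory is that of some generic model, and any two generic models are
    elementarily equivalent by back-and-forth from the empty map. *)
Lemma generic_models A : generic_model K A -> models (to_str A) (generic_theory K).
Proof.
move=> gA p [A' gA']; rewrite /holds.
have bf := extendable_back_and_forth (generic_extendable gA' gA)
  (generic_extendable gA gA').
have [X [_ hX]] := sat_back_and_forth bf p.
move/(hX set0); apply=> [|[]]; split; first exact: finite_set0.
exact: generic_piso0.
Qed.

End Generic.
End Pisos.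

(** * Quantifier-free diagrams *)

Section Diagrams.
Variable sg : rsig.
Implicit Types M N : structure (rel_lang sg).
Implicit Types J : finType.

(** As the signature and J are finite, a J-tuple has finitely many atomic
    properties, so that its quantifier-free type is a single formula. *)
Definition diag_atom J : finType :=
  ((J * J) + {R : sg & {ffun 'I_(rarity R) -> J}})%type.

Definition atom J (t : diag_atom J) M (z : J -> M tt) : Prop :=
  match t with
  | inl ij => z ij.1 = z ij.2
  | inr Rs => rint (s := M) (R := tag Rs : rsym (rel_lang sg))
                (fun i => z (tagged Rs i))
  end.

Definition same_diag J M N (z : J -> M tt) (z' : J -> N tt) : Prop :=
  forall t, atom t z <-> atom t z'.

Lemma same_diagP J M N (z : J -> M tt) (z' : J -> N tt) :
  same_diag z z' <-> piso (range (fun j => (z j, z' j))).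
Proof.
split=> [zz'|[eqP relP] [[i j]|[R s]]].
- split; first by move=> _ _ [i _ <-] [j _ <-]; exact: (zz' (inl (i, j))).
  move=> R w /= Pw.
  have /choice[s sE] i : exists j, (z j, z' j) = w i by have [j _ <-] := Pw i; exists j.
  have := zz' (inr (Tagged (fun R : sg => {ffun 'I_(rarity R) -> J}) (finfun s))) => /=.
  have -> : (fun i => z ([ffun x => s x] i)) = (fun i => (w i).1).
    by apply: funextd => i; rewrite ffunE -sE.
  have -> // : (fun i => z' ([ffun x => s x] i)) = (fun i => (w i).2).
  by apply: funextd => i; rewrite ffunE -sE.
- by apply: (eqP (z i, z' i) (z j, z' j)); [exists i|exists j].
- by apply: (relP R (fun i => (z (s i), z' (s i)))) => i; exists (s i).
Qed.

Lemma same_diag_sym J M N (z : J -> M tt) (z' : J -> N tt) :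
  same_diag z z' -> same_diag z' z.
Proof. by move=> h t; rewrite h. Qed.

Lemma same_diag_trans J M1 M2 M3 (z1 : J -> M1 tt) (z2 : J -> M2 tt)
    (z3 : J -> M3 tt) :
  same_diag z1 z2 -> same_diag z2 z3 -> same_diag z1 z3.
Proof. by move=> h12 h23 t; rewrite h12. Qed.

Lemma same_diag_comp J (I : finType) (f : I -> J) M N (z : J -> M tt) (z' : J -> N tt) :
  same_diag z z' -> same_diag (z \o f) (z' \o f).
Proof.
move=> /same_diagP h; apply/same_diagP; apply: piso_sub h.
by move=> _ [i _ <-]; exists (f i).
Qed.

Lemma def_atom V (S : V -> sorts (rel_lang sg)) J (t : diag_atom J)
    (F : J -> forall M, env M S -> M tt) :
  (forall j, @term_definable (rel_lang sg) V S tt (F j)) ->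
  definable (fun M (e : env M S) => atom t (fun j => F j M e)).
Proof.
move=> dF; case: t => [[i j]|[R s]] /=; first exact: def_eq.
by apply: (def_rel (R := R : rsym (rel_lang sg)) (F := fun i M e => F (s i) M e)).
Qed.

Lemma def_same_diag V (S : V -> sorts (rel_lang sg)) J (b : diag_atom J -> Prop)
    (F : J -> forall M, env M S -> M tt) :
  (forall j, @term_definable (rel_lang sg) V S tt (F j)) ->
  definable (fun M (e : env M S) => forall t, atom t (fun j => F j M e) <-> b t).
Proof.
move=> dF; apply: def_forallfin => t; apply: def_iff; last exact: def_const.
exact: def_atom.
Qed.

Variables (K : str_class sg) (A : rstr sg).
Hypothesis gA : generic_model K A.

(** A sentence true in one generic model belongs to the theory. *)
Lemma theory_transfer (P : structure (rel_lang sg) -> Prop) M :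
  @definable (rel_lang sg) void (of_void _) (fun N _ => P N) ->
  models M (generic_theory K) -> P (to_str A) -> P M.
Proof.
move=> /def_sentence[p pP] MT PA; apply/pP/MT; exists A => //.
exact/pP.
Qed.

(** Otherwise the sentence that the diagram is not realized would hold in A, hence
    in M. *)
Lemma model_diag_realized M J (z : J -> M tt) :
  models M (generic_theory K) -> exists z' : J -> A, same_diag (N := to_str A) z z'.
Proof.
move=> MT; apply: contrapT => nz.
have := @theory_transfer
  (fun N => ~ exists z' : J -> N tt, forall t, atom t z' <-> atom t z) M.
apply; [|exact: MT| |by exists z].
- apply: def_not; apply: (def_exs (s := tt : sorts (rel_lang sg))
    (P := fun M e z' => forall t, atom t z' <-> atom t z)).
  apply: def_same_diag => j.
  exact: (@tdef_id (rel_lang sg) _ (ctx_cat (of_void _) (fun _ : J => tt)) (inr j)).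
- by move=> [z' zz']; apply: nz; exists z' => t; rewrite zz'.
Qed.

(** The extension axiom from the diagram of z' to that of (z', x') holds in A by
    ultrahomogeneity, and it is a sentence. *)
Lemma model_diag_extended M J (z : J -> M tt) (z' : J -> A) (x' : A) :
  models M (generic_theory K) -> same_diag (N := to_str A) z z' ->
  exists x : M tt,
    same_diag (N := to_str A) (fun o => oapp z x o) (fun o => oapp z' x' o).
Proof.
move=> MT zz'.
pose Ext N := forall u : J -> N tt,
  (forall t, atom t u <-> atom (M := to_str A) t z') ->
  exists x, forall t, atom t (fun o => oapp u x o) <->
                      atom (M := to_str A) t (fun o => oapp z' x' o).
suff /(_ z zz')[x xP] : Ext M by exists x.
apply: theory_transfer MT _.
  apply: (def_alls (s := tt : sorts (rel_lang sg)) (S := of_void _)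
    (P := fun N e u => (forall t, atom t u <-> atom (M := to_str A) t z') ->
  exists x, forall t, atom t (fun o => oapp u x o) <->
                      atom (M := to_str A) t (fun o => oapp z' x' o))).
  apply: def_imp.
    apply: def_same_diag => j.
    exact: (@tdef_id (rel_lang sg) _ (ctx_cat (of_void _) (fun _ : J => tt)) (inr j)).
  refine (@def_ex (rel_lang sg) (void + J) (ctx_cat (of_void _) (fun=> tt)) tt
    (fun N e x => forall t,
       atom (M := N) t (fun o => oapp (fun i : J => e (inr i) : N tt) x o) <->
       atom (M := to_str A) t (fun o => oapp z' x' o)) _).
  pose G : option (void + J) -> sorts (rel_lang sg) :=
    ctx_cons tt (ctx_cat (of_void _) (fun=> tt)).
  apply: (@def_same_diag _ G (option J) _
    (fun o N e => oapp (fun i : J => e (Some (inr i)) : N tt) (e None) o)).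
  case=> [j|].
    exact: (@tdef_id (rel_lang sg) _ G (Some (inr j))).
  exact: (@tdef_id (rel_lang sg) _ G None).
move=> u uz'.
have [_ _ homA] := gA.
have fu : finite_set (range (fun j => (z' j, u j))) by exact/finite_image/finite_finset.
have [t isot tP] := piso_aut homA fu
  ((same_diagP (M := to_str A) (N := to_str A) z' u).1 (same_diag_sym uz')).
exists (t x'); apply: same_diag_sym; apply/(same_diagP (M := to_str A) (N := to_str A)).
apply: piso_sub (emb_piso isot.1) => _ [[j|] _ <-] //=.
by apply: (tP (z' j, u j)); exists j.
Qed.

(** Any two models of the theory are compared through the generic model A: the
    diagram of the extended tuple of M is realized in A, from where it is copied
    to N. *)
Lemma models_extendable M N : models M (generic_theory K) ->
  models N (generic_theory K) -> extendable M N.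
Proof.
move=> MT NT P finP pisoP x; have [n [w PE]] := finite_range finP.
have [z zP] := model_diag_realized
  (fun o => oapp (fun i : 'I_n => (w i).1) x o) MT.
have Nz : same_diag (M := N) (N := to_str A) (fun i => (w i).2) (fun i => z (Some i)).
  have /same_diagP : piso (range (fun i => ((w i).1, (w i).2))).
    apply: piso_sub pisoP => p; rewrite PE => -[i _ <-].
    by exists i => //; rewrite -surjective_pairing.
  move=> /same_diag_sym h; apply: same_diag_trans h _.
  exact: (same_diag_comp (Some : _ -> option _) zP).
have [x' x'P] := model_diag_extended (z None) NT Nz; exists x'.
have zE : (fun o => oapp (fun i => z (Some i)) (z None) o) = z.
  by apply: funextd => -[].
rewrite zE in x'P.
have /same_diagP := same_diag_trans zP (same_diag_sym x'P).
apply: piso_sub => p [|->]; last by exists None.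
by rewrite PE => -[i _ <-]; exists (Some i) => //=; rewrite -surjective_pairing.
Qed.

Lemma models_back_and_forth M N : models M (generic_theory K) ->
  models N (generic_theory K) -> back_and_forth (@finpiso sg M N).
Proof.
by move=> MT NT; apply: extendable_back_and_forth; apply: models_extendable.
Qed.

Lemma models_piso0 M N : models M (generic_theory K) ->
  models N (generic_theory K) -> piso (set0 : set (M tt * N tt)).
Proof.
move=> MT NT.
have [z zP] := model_diag_realized (fun i : void => match i with end : M tt) MT.
have [z' z'P] := model_diag_realized (fun i : void => match i with end : N tt) NT.
have zz' : z = z' by apply: funextd => -[].
rewrite -zz' in z'P.
have /same_diagP := same_diag_trans zP (same_diag_sym z'P).
exact: piso_sub.
Qed.

End Diagrams.

(** * Conjugates over finite sets *)

(** Otherwise the diagram of c over X is a formula with parameters in X, true of c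
    and with finitely many solutions, which puts c in the algebraic closure of X,
    that is in X. *)
Lemma infinite_conjugates (sg : rsig) (K : str_class sg) (N : rstr sg)
    (X : set N) (c : N) :
  generic_model K N -> algebraically_trivial K -> finite_set X -> ~ X c ->
  infinite_set [set c' | piso (M := to_str N) (M' := to_str N)
    ([set p | X p.1 /\ p.1 = p.2] `|` [set (c, c')])].
Proof.
move=> gN trivK finX nXc finS; apply: nXc.
rewrite -(trivK (to_str N) (generic_models gN) X).
have [n [f XE]] := finite_range finX.
have Xf i : X (f i) by rewrite XE; exists i.
pose V : Type := (unit + {x : N | X x})%type.
pose var (o : option 'I_n) : V :=
  if o is Some i then inr (exist _ (f i) (Xf i)) else inl tt.
pose z (c' : N) (o : option 'I_n) : N := oapp f c' o.
have [phi phiP] := def_form (@def_same_diag sg V (fun=> tt) (option 'I_n)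
  (fun t => atom (M := to_str N) t (z c)) (fun o M e => e (var o))
  (fun o => @tdef_id (rel_lang sg) V (fun=> tt) (var o))).
have phiE (b : unit -> N) : sat (M := to_str N) phi (with_params (M := to_str N) X b) <->
    same_diag (M := to_str N) (N := to_str N) (z (b tt)) (z c).
  rewrite phiP.
  suff -> : (fun o => with_params (M := to_str N) (s := tt) X b (var o)) = z (b tt) by [].
  by apply: funextd => -[i|] /=.
exists phi; first by apply/phiE => t.
apply: sub_finite_set (finite_image (fun c' (_ : unit) => c') finS) => b /= /phiE bc.
exists (b tt) => /=; last by apply: funextd => -[].
have /(same_diagP (M := to_str N) (N := to_str N)) := same_diag_sym bc.
apply: piso_sub => p [[Xp ep]|->]; last by exists None.
move: Xp; rewrite XE => -[i _ fi]; exists (Some i) => //.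
by rewrite /= fi {2}ep -surjective_pairing.
Qed.

(** * Imaginaries as tuples of points *)

Section Imaginaries.
Variables (sg : rsig) (T : theory (rel_lang sg)).

Definition home (M : structure (eq_lang T)) : structure (rel_lang sg) :=
  @Structure (rel_lang sg) (fun u => M (inl u))
    (fun f : void => match f with end)
    (fun (R : sg) x => rint (s := M) (R := R : rsym (eq_lang T)) x).

Lemma sat_home_eq_str (M : structure (rel_lang sg)) V (G : V -> unit)
    (p : form (L := rel_lang sg) G) (e : env M G) :
  sat (M := home (eq_str T M)) p e <-> sat p e.
Proof.
case: M e => car fint rint e; rewrite /home /=.
suff -> : (fun f : void => match f with end) = fint by [].
by apply: funextd => -[].
Qed.

(** Formulas about points are formulas of the larger language, by induction on
    their syntax. *)
Lemma def_home V (G : V -> unit) (p : form (L := rel_lang sg) G) :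
  @definable (eq_lang T) V (fun v => inl (G v)) (fun M e => sat (M := home M) p e).
Proof.
have tdef_home W (H : W -> unit) s (t : term (L := rel_lang sg) H s) :
    @term_definable (eq_lang T) W (fun v => inl (H v)) (inl s)
      (fun M e => eval (M := home M) e t).
  by case: t => [v|[]]; exact: (@tdef_id (eq_lang T) W (fun v => inl (H v)) v).
elim: p => {V G} [V G|V G s t u|V G R args|V G p IHp q IHq|V G s p IH] /=.
- exact: def_bot.
- by apply: (@def_eq (eq_lang T) V _ (inl s)); exact: tdef_home.
- apply: (@def_rel (eq_lang T) V _ R (fun i M e => eval (M := home M) e (args i))) => i.
  exact: tdef_home.
- exact: def_imp.
apply: (@def_all (eq_lang T) V _ (inl s)
  (fun M e x => sat (M := home M) p (@env_cons _ (home M) V G s x e))).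
have h (o : option V) : ctx_cons (inl s : sorts (eq_lang T)) (fun v => inl (G v)) o =
  inl (ctx_cons s G o) by case: o.
apply: def_ext (def_ren (f := id) h IH) => M e.
suff -> : pull h e = @env_cons _ (home M) V G s (e None) (fun v => e (Some v)) by [].
by apply: funextd => -[v|]; rewrite /pull tr_id.
Qed.

Lemma eq_theory_transfer (P : structure (eq_lang T) -> Prop) M :
  @definable (eq_lang T) void (of_void _) (fun N _ => P N) ->
  models M (eq_theory T) ->
  (forall N, models N T -> P (eq_str T N)) -> P M.
Proof.
move=> /def_sentence[p pP] MT PT; apply/pP/MT => N NT.
exact/pP/PT.
Qed.

Lemma home_models M : models M (eq_theory T) -> models (home M) T.
Proof.
move=> MT p Tp; apply: (eq_theory_transfer (P := fun M => holds (home M) p)) MT _.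
  have h (v : void) : of_void (sorts (eq_lang T)) v = inl (of_void unit v) by case: v.
  apply: def_ext (def_ren (f := id) h (def_home p)) => N e.
  suff -> : pull h e =
    (fun v : void => match v return home N (of_void _ v) with end) by [].
  by apply: funextd => -[].
by move=> N NT; exact: (sat_home_eq_str p _).2 (NT p Tp).
Qed.

Lemma eq_str_models (N : structure (rel_lang sg)) :
  models N T -> models (eq_str T N) (eq_theory T).
Proof. by move=> NT p; apply. Qed.

(** An element of any sort is the image under [proj] of a tuple of points, of
    length [width s]; a point is the image of its own 1-tuple.  Treating both kinds
    of sorts alike avoids most case distinctions below. *)
Definition width (s : sorts (eq_lang T)) : nat :=
  match s with inl _ => 1 | inr E => inum E end.

Definition at_sort (M : structure (eq_lang T)) (u : unit) (x : M (inl tt)) :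
    M (inl u) :=
  tr (match u return (inl tt : sorts (eq_lang T)) = inl u with tt => erefl end) x.

Definition proj (M : structure (eq_lang T)) (s : sorts (eq_lang T)) :
    ('I_(width s) -> M (inl tt)) -> M s :=
  match s return ('I_(width s) -> M (inl tt)) -> M s with
  | inl u => fun z => at_sort u (z ord0)
  | inr E => fun z => fint (s := M) (f := inr E : fsym (eq_lang T))
                        (fun i => at_sort (ictx (i := E) i) (z i))
  end.

Lemma cell_at_sort (M : structure (eq_lang T)) u (x : M (inl tt)) :
  cell (M := home M) (at_sort u x) = x.
Proof. by case: u. Qed.

Lemma tdef_proj V (S : V -> sorts (eq_lang T)) s
    (F : 'I_(width s) -> forall M : structure (eq_lang T), env M S -> M (inl tt)) :
  (forall i, term_definable (F i)) ->
  term_definable (fun M e => proj (fun i => F i M e)).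
Proof.
have tdef_at u (G : forall M : structure (eq_lang T), env M S -> M (inl tt)) :
    term_definable G -> term_definable (fun M e => at_sort u (G M e)) by case: u.
case: s F => [u|E] F dF /=; first exact: tdef_at.
apply: (@tdef_app (eq_lang T) V S (inr E)
  (fun i M e => at_sort (ictx (i := E) i) (F i M e))) => i.
exact: tdef_at.
Qed.

Lemma proj_surj (M : structure (eq_lang T)) (s : sorts (eq_lang T)) (x : M s) :
  models M (eq_theory T) -> exists z, x = proj z.
Proof.
move=> MT; move: x; apply: (eq_theory_transfer
  (P := fun M => forall x : M s, exists z, x = proj z)) MT _.
  apply: (@def_all _ _ _ s (fun M e x => exists z, x = proj z)).
  apply: (@def_exs (eq_lang T) _ _ (inl tt) 'I_(width s) (fun M e z => e None = proj z)).
  apply: def_eq; first exact: tdef_id (inl None).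
  by apply: tdef_proj => i; exact: tdef_id (inr i).
move=> N NT; case: s => [[] x|E [C [a Ca]]]; first by exists (fun=> x).
subst C; exists (fun i => cell (M := N) (a i)) => /=.
suff -> : (fun i => at_sort (M := eq_str T N) (ictx (i := E) i)
                      (cell (M := N) (a i))) = a by [].
by apply: funextd => i; move: (a i); case: (ictx (i := E) i).
Qed.

Definition two_tuples (M : structure (eq_lang T)) (E : imag T)
    (a b : 'I_(width (inr E)) -> M (inl tt)) :
    env (home M) (ctx_cat (ictx (i := E)) (ictx (i := E))) :=
  env_cat (M := home M) (fun i => at_sort (ictx (i := E) i) (a i))
                        (fun i => at_sort (ictx (i := E) i) (b i)).

Lemma proj_eq (M : structure (eq_lang T)) (E : imag T)
    (a b : 'I_(width (inr E)) -> M (inl tt)) :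
  models M (eq_theory T) ->
  proj a = proj b <-> sat (M := home M) (iform E) (two_tuples a b).
Proof.
set I := 'I_(width (inr E)).
move=> MT; move: a b; apply: (eq_theory_transfer (P := fun M =>
  forall a b : I -> M (inl tt),
  proj a = proj b <-> sat (M := home M) (iform E) (two_tuples a b))) MT _.
  pose c u : (inl tt : sorts (eq_lang T)) = inl u := match u with tt => erefl end.
  apply: (@def_alls (eq_lang T) _ _ (inl tt) I (fun M e a => forall b,
    proj a = proj b <-> sat (M := home M) (iform E) (two_tuples a b))).
  apply: (@def_alls (eq_lang T) _ _ (inl tt) I (fun M e b =>
    let a := fun i => e (inr i) in
    proj a = proj b <-> sat (M := home M) (iform E) (two_tuples a b))).
  apply: def_iff.
    apply: def_eq; apply: tdef_proj => i; first exact: tdef_id (inl (inr i)).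
    exact: tdef_id (inr i).
  pose f (v : 'I_(inum E) + 'I_(inum E)) : (void + I) + I :=
    match v with inl i => inl (inr i) | inr i => inr i end.
  pose S := ctx_cat (ctx_cat (of_void (sorts (eq_lang T))) (fun _ : I => inl tt))
                    (fun _ : I => inl tt).
  have h v : S (f v) = inl (ctx_cat (ictx (i := E)) (ictx (i := E)) v).
    by case: v => i; exact: c.
  apply: def_ext (def_ren h (def_home (iform E))) => N e.
  suff -> : pull h e =
    two_tuples (fun i => e (inl (inr i))) (fun i => e (inr i)) by [].
  by apply: funextd => -[i|i]; rewrite /pull /= /at_sort; congr tr;
    exact: Prop_irrelevance.
move=> N NT a b.
apply: iff_trans (iff_sym (sat_home_eq_str (M := N) (iform E) _)) => /=.
have [rfl symm tran] := iequiv E NT.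
split=> [/(congr1 sval) /= e|hab].
  pose b' i := at_sort (M := eq_str T N) (ictx (i := E) i) (b i).
  have : iclass (M := N) b' b' by exact: rfl.
  by rewrite -e.
apply: eq_exist; apply/seteqP; split=> x; last exact: tran.
by apply: tran; exact: symm.
Qed.

Lemma tuple_eq_form k :
  exists q : form (L := rel_lang sg) (ctx_cat (fun _ : 'I_k => tt) (fun _ : 'I_k => tt)),
    forall M (e : env M _), sat q e <-> forall i : 'I_k, (e (inl i) : M tt) = e (inr i).
Proof.
apply: def_form; apply: def_forallfin => i.
apply: (@def_eq (rel_lang sg) _ _ tt); first exact: tdef_id (inl i).
exact: tdef_id (inr i).
Qed.

Lemma tuple_eq_equiv k M : models M T ->
  let q := sval (cid (tuple_eq_form k)) in
  [/\ forall a : env M (fun _ : 'I_k => tt : sorts (rel_lang sg)), sat q (env_cat a a),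
      forall a b : env M (fun _ : 'I_k => tt), sat q (env_cat a b) -> sat q (env_cat b a)
    & forall a b c : env M (fun _ : 'I_k => tt),
        sat q (env_cat a b) -> sat q (env_cat b c) -> sat q (env_cat a c)].
Proof.
move=> _ q; have qP := svalP (cid (tuple_eq_form k)).
split=> [a|a b /qP ab|a b c /qP ab /qP bc]; apply/qP => i //=.
  exact: esym (ab i).
exact: etrans (ab i) (bc i).
Qed.

(** The sort of [k]-tuples of points: imaginaries for the equality of tuples. *)
Definition tuple_imag k : imag T := Imag (@tuple_eq_equiv k).

Lemma proj_tuple_inj k (M : structure (eq_lang T)) (a b : 'I_k -> M (inl tt)) :
  models M (eq_theory T) ->
  proj (s := inr (tuple_imag k)) a = proj (s := inr (tuple_imag k)) b -> a = b.
Proof.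
move=> MT /(proj_eq (E := tuple_imag k) a b MT).
move=> /(svalP (cid (tuple_eq_form k))) ab.
by apply: funextd => i; exact: (ab i).
Qed.

Section Bisimulation.
Variables (M N : structure (eq_lang T)).
Hypotheses (MT : models M (eq_theory T)) (NT : models N (eq_theory T)).
Hypotheses (eMN : extendable (home M) (home N)) (eNM : extendable (home N) (home M)).

(** Elements of the same sort are related over P when tuples of points that P
    matches represent them. *)
Definition lifts (P : set (M (inl tt) * N (inl tt))) (s : sorts (eq_lang T))
    (x : M s) (y : N s) : Prop :=
  exists w : 'I_(width s) -> M (inl tt) * N (inl tt),
  [/\ forall i, P (w i), x = proj (fun i => (w i).1) & y = proj (fun i => (w i).2)].

Lemma lifts_sub (P Q : set (M (inl tt) * N (inl tt))) s (x : M s) (y : N s) :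
  P `<=` Q -> lifts P x y -> lifts Q x y.
Proof. by move=> PQ [w [Pw -> ->]]; exists w; split=> // i; exact: PQ. Qed.

(** Equality of imaginaries is a formula about representatives, and P preserves
    formulas. *)
Lemma lifts_eq P s (x x' : M s) (y y' : N s) : @finpiso sg (home M) (home N) P ->
  lifts P x y -> lifts P x' y' -> (x = x' <-> y = y').
Proof.
move=> FP [w [Pw -> ->]] [w' [Pw' -> ->]].
case: s w w' Pw Pw' {x x' y y'} => [[]|E] w w' Pw Pw'.
  by case: FP => _ [eqP _]; exact: eqP.
rewrite !proj_eq //.
have bf := extendable_back_and_forth eMN eNM.
have [X [_ hX]] := sat_back_and_forth bf (iform E).
apply: (hX P) => // -[i|i] _; rewrite /flat /= !cell_at_sort.
  by rewrite -surjective_pairing.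
by rewrite -surjective_pairing.
Qed.

Lemma lifts_term P V (G : V -> sorts (eq_lang T)) s (t : term G s)
    (e : env M G) (e' : env N G) :
  (forall v, lifts P (e v) (e' v)) -> lifts P (eval e t) (eval e' t).
Proof.
move=> Pe; elim: t => [v|[[]|E] args IH] //=.
have w i := cid (IH i).
exists (fun i => sval (w i) ord0); split.
- by move=> i; have [Pw _ _] := svalP (w i); exact: Pw.
- congr (fint (f := inr E : fsym (eq_lang T)) _); apply: funextd => i.
  by have [_ wi _] := svalP (w i); exact: wi.
- congr (fint (f := inr E : fsym (eq_lang T)) _); apply: funextd => i.
  by have [_ _ wi] := svalP (w i); exact: wi.
Qed.

(** Back-and-forth for all sorts at once: a quantifier over an imaginary sort is
    matched by extending P along a tuple that represents its value. *)
Lemma sat_lifts V (G : V -> sorts (eq_lang T)) (p : form G) :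
  forall P (e : env M G) (e' : env N G), @finpiso sg (home M) (home N) P ->
  (forall v, lifts P (e v) (e' v)) -> (sat p e <-> sat p e').
Proof.
elim: p => {V G} [V G|V G s t u|V G R args|V G p IHp q IHq|V G s p IH] P e e' FP Pe //=.
- by apply: lifts_eq FP _ _; exact: lifts_term.
- have w i := cid (lifts_term (args i) Pe).
  have [_ [_ relP]] := FP.
  have Pw i : P (sval (w i) ord0) by have [Pw _ _] := svalP (w i); exact: Pw.
  have /= := relP R _ Pw.
  have -> : (fun i => (sval (w i) ord0).1) = (fun i => eval e (args i)).
    by apply: funextd => i; have [_ wi _] := svalP (w i); exact: esym wi.
  have -> // : (fun i => (sval (w i) ord0).2) = (fun i => eval e' (args i)).
  by apply: funextd => i; have [_ _ wi] := svalP (w i); exact: esym wi.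
- by rewrite (IHp P e e') // (IHq P e e').
have [finP pisoP] := FP; split=> hp x.
  have [z ->] := proj_surj x NT.
  have [z' [finQ pisoQ]] := extendable_tuple (M := home N) (N := home M) z eNM
    (finite_swap finP) (piso_swap pisoP).
  pose x' : M s := proj (M := M) z'.
  apply: (IH _ (env_cons x' e) (env_cons (proj z) e') _ _).1 (hp x').
    by split; [exact: finite_swap finQ|exact: piso_swap pisoQ].
  case=> [v|] /=; last by exists (fun i => (z' i, z i)); split=> // i; right; exists i.
  by apply: lifts_sub (Pe v) => -[a b] Pab; left.
have [z ->] := proj_surj x MT.
have [z' [finQ pisoQ]] := extendable_tuple (M := home M) (N := home N) z eMN finP pisoP.
pose x' : N s := proj (M := N) z'.
apply: (IH _ (env_cons (proj z) e) (env_cons x' e') _ _).2 (hp x').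
  by split; [exact: finQ|exact: pisoQ].
case=> [v|] /=; last by exists (fun i => (z i, z' i)); split=> // i; right; exists i.
by apply: lifts_sub (Pe v) => -[a b] Pab; left.
Qed.

End Bisimulation.
End Imaginaries.

(** * Transferring a theory along a map of generic models *)

Lemma infinite_avoid (T : Type) (X Y : set T) :
  infinite_set X -> finite_set Y ->
  exists h : nat -> T, injective h /\ forall n, ~ Y (h n).
Proof.
move=> infX finY; have /infiniteP/card_leP[h] := infinite_setD infX finY.
pose el n : [set: nat] := SigSub (mem_set (I : [set: nat] n)).
exists (fun n => \val (h (el n))); split; last by move=> n; have /set_mem[] := valP (h (el n)).
move=> i j /val_inj hij; have := @inj _ _ _ h (el i) (el j).
by rewrite !inE => /(_ I I hij) [].
Qed.

(** A map v between generic models that reflects quantifier-free types turns every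
    formula of T, imaginaries included, into a formula of T': elements of a sort
    of T are given by tuples of points, and v moves those to N. *)

Section Transfer.
Variables (sg sg' : rsig) (K : str_class sg) (K' : str_class sg').
Variables (A : rstr sg) (N : rstr sg').
Hypotheses (gA : generic_model K A) (gN : generic_model K' N).
Hypothesis trivK' : algebraically_trivial K'.
Variable v : A -> N.
Hypothesis v_reflects : forall P : set (A * A),
  piso (M := to_str N) (M' := to_str N) ((fun p => (v p.1, v p.2)) @` P) ->
  piso (M := to_str A) (M' := to_str A) P.

Let T := generic_theory K.
Let T' := generic_theory K'.
Let AT : models (to_str A) T := generic_models gA.
Let NT : models (to_str N) T' := generic_models gN.
Let AE : models (eq_str T (to_str A)) (eq_theory T) := eq_str_models AT.
Let NE : models (eq_str T' (to_str N)) (eq_theory T') := eq_str_models NT.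

Let EN := eq_str T' (to_str N).
Let EA := eq_str T (to_str A).

(** An element of a sort of T is coded in T' by the image of a representing tuple
    preceded by one more point.  A fresh choice of that point makes any family of
    codes algebraically independent, whatever the dependencies between the coded
    elements. *)
Definition padded m (x : 'I_m -> N) (c : N) : 'I_m.+1 -> N :=
  fun i => oapp x c (unlift ord0 i).

Definition padded_tuple m (x : 'I_m -> N) (c : N) :
    EN (inr (tuple_imag T' m.+1)) :=
  proj (M := EN) (s := inr (tuple_imag T' m.+1)) (padded x c).

Lemma home_extendable (M M' : structure (eq_lang T')) :
  models M (eq_theory T') -> models M' (eq_theory T') -> extendable (home M) (home M').
Proof. by move=> MT MT'; apply: (models_extendable gN); exact: home_models. Qed.

Lemma home_extendableA (M M' : structure (eq_lang T)) :
  models M (eq_theory T) -> models M' (eq_theory T) -> extendable (home M) (home M').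
Proof. by move=> MT MT'; apply: (models_extendable gA); exact: home_models. Qed.

(** The truth of phi at imaginaries depends on the diagram in A of representatives,
    hence, as v reflects diagrams, on the diagram in N of their images; there are
    finitely many diagrams, and phi' is the disjunction of the favourable ones. *)
Lemma translation s k (phi : form (L := eq_lang T) (fun _ : 'I_k => s)) :
  exists phi' : form (L := eq_lang T') (fun _ : 'I_k => inr (tuple_imag T' (width s).+1)),
    forall (y : 'I_k -> 'I_(width s) -> A) (c : 'I_k -> N),
      sat (M := EN) phi' (fun j => padded_tuple (v \o y j) (c j)) <->
      sat (M := EA) phi (fun j => proj (M := EA) (y j)).
Proof.
set m := width s; set E := tuple_imag T' m.+1.
pose Psi (M : structure (rel_lang sg')) (z : 'I_k * 'I_m -> M tt) :=
  exists y : 'I_k * 'I_m -> A,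
    same_diag (N := to_str N) z (v \o y) /\
    sat (M := EA) phi (fun j => proj (M := EA) (fun l => y (j, l))).
have [psi psiP] : exists psi : form (L := rel_lang sg') (fun _ : 'I_k * 'I_m => tt),
    forall M e, sat psi e <-> @Psi M e.
  apply: def_form; apply: (def_fintype (T := diag_atom sg' ('I_k * 'I_m)%type)
    (a := fun t M e => atom t (fun j => e j))).
    by move=> t; apply: def_atom => j; exact: tdef_id.
  move=> M e M' e' ee' [y [ey phiy]]; exists y; split=> //.
  by apply: same_diag_trans ey; apply: same_diag_sym.
have [p pP] : exists p : form (L := eq_lang T') (fun _ : 'I_k => inr E),
    forall (M : structure (eq_lang T')) (e : env M (fun _ : 'I_k => inr E)),
    sat p e <-> exists z : 'I_k * 'I_m.+1 -> M (inl tt),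
      (forall j, e j = proj (M := M) (s := inr E) (fun l => z (j, l))) /\
      @Psi (home M) (fun jl => z (jl.1, lift ord0 jl.2)).
  set J := ('I_k * 'I_m.+1)%type.
  apply: def_form.
  apply: (@def_exs (eq_lang T') _ _ (inl tt) J (fun M e z =>
    (forall j, e j = proj (M := M) (s := inr E) (fun l => z (j, l))) /\
    @Psi (home M) (fun jl => z (jl.1, lift ord0 jl.2)))).
  apply: def_and.
    apply: def_forallfin => j; apply: def_eq; first exact: tdef_id (inl j).
    by apply: (@tdef_proj _ T' _ _ (inr E)) => l; exact: tdef_id (inr (j, l)).
  pose f (jl : 'I_k * 'I_m) : 'I_k + J := inr (jl.1, lift ord0 jl.2).
  pose S' : 'I_k + J -> sorts (eq_lang T') := ctx_cat (fun=> inr E) (fun=> inl tt).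
  pose h jl : S' (f jl) = inl tt := erefl.
  by apply: def_ext (def_ren h (@def_home _ T' _ _ psi)) => M e; exact: psiP.
exists p => y c; rewrite pP; split=> [[z [zE [y' [zy' phiy']]]]|phiy]; last first.
  exists (fun jl => padded (v \o y jl.1) (c jl.1) jl.2); split=> //.
  exists (fun jl => y jl.1 jl.2); split=> //.
  suff -> : (fun jl : 'I_k * 'I_m => padded (v \o y jl.1) (c jl.1) (lift ord0 jl.2)) =
    v \o (fun jl => y jl.1 jl.2).
    by [].
  by apply: funextd => jl; rewrite /padded liftK.
have zE' : (fun jl : 'I_k * 'I_m => z (jl.1, lift ord0 jl.2)) =
    v \o (fun jl => y jl.1 jl.2).
  apply: funextd => -[j l] /=.
  have /(congr1 (fun x => x (lift ord0 l))) := proj_tuple_inj NE (zE j).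
  by rewrite /padded liftK => <-.
rewrite zE' in zy'.
have {zy'} : same_diag (M := to_str N) (N := to_str N)
    (v \o (fun jl => y jl.1 jl.2)) (v \o y') by exact: zy'.
move=> /(same_diagP (M := to_str N) (N := to_str N)).
set P := range (fun jl => (y jl.1 jl.2, y' jl)).
have -> : range (fun jl => ((v \o (fun jl => y jl.1 jl.2)) jl, (v \o y') jl)) =
    (fun p => (v p.1, v p.2)) @` P.
  by rewrite /P image_comp.
move=> /v_reflects pisoP.
have eA := home_extendableA AE AE.
apply: (@sat_lifts _ _ _ _ AE AE eA eA _ _ phi P _ _ _ _).2 phiy'.
  by split; [exact/finite_image/finite_finset|exact: pisoP].
by move=> j; exists (fun l => (y j l, y' (j, l))); split=> // l; exists (j, l).
Qed.

Lemma generic_infinite : inhabited A -> infinite_set [set: N].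
Proof.
move=> [a]; have := infinite_conjugates (c := v a) gN trivK' (finite_set0 N) (fun h => h).
by apply: sub_infinite_set.
Qed.

(** Given a set B0 of indices and b1 outside it, the extra coordinate c b1 can be
    moved to infinitely many places by partial isomorphisms that fix all other
    coordinates, so each formula over the tuples at B0 that holds of the family
    has infinitely many solutions. *)
Lemma padded_inF m (B : {fset nat}) (x : B -> 'I_m -> N) (c : B -> N) :
  injective c -> (forall b b' l, c b <> x b' l) ->
  inF (M := EN) (fun b => padded_tuple (x b) (c b)).
Proof.
move=> injc cx.
have padded0 y d : @padded m y d ord0 = d by rewrite /padded unlift_none.
have tuple_eq y d y' d' : @padded_tuple m y d = padded_tuple y' d' -> d = d'.
  by move=> /(proj_tuple_inj NE)/(congr1 (@^~ ord0)); rewrite !padded0.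
split=> [b b' /tuple_eq/injc //|B0 [B0T nB0] [phi phif finS]].
have [b1 nB1] : exists b1, ~ B0 b1.
  by apply: contrapT => /forallNP B0b; apply: nB0 => b _; apply: contrapT; exact: B0b.
pose X := range (fun bl : B * 'I_m => x bl.1 bl.2) `|` (c @` [set b | b <> b1]).
have finX : finite_set X.
  by rewrite finite_setU; split; apply: finite_image; exact: finite_finset.
have nXc : ~ X (c b1).
  by move=> [[[b l] _ /= e]|[b /= nb /injc //]]; exact: (cx b1 b l).
apply: (infinite_conjugates gN trivK' finX nXc).
pose c' d b := if b == b1 then d else c b.
pose F (d : N) (b : B) := padded_tuple (x b) (c' d b).
suff SF : [set d | piso (M := to_str N) (M' := to_str N)
    ([set p | X p.1 /\ p.1 = p.2] `|` [set (c b1, d)])] `<=`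
    F @^-1` [set f | sat phi
      (with_params (M := EN) ((fun b => padded_tuple (x b) (c b)) @` B0) f)].
  apply: sub_finite_set SF _; apply: finite_preimage finS => d d' _ _ /(congr1 (@^~ b1)).
  by rewrite /F /c' eqxx => /tuple_eq.
move=> d /=; set P := (_ `|` _) => pisoP.
have eN := home_extendable NE NE.
apply: (@sat_lifts _ _ _ _ NE NE eN eN _ _ phi P _ _ _ _).1 phif.
  split; last exact: pisoP.
  rewrite finite_setU; split; last exact: finite_set1.
  apply: sub_finite_set (finite_image (fun a => (a, a)) finX).
  by move=> [a a'] /= [Xa <-]; exists a.
have Pid b l : b <> b1 -> P (padded (x b) (c b) l, padded (x b) (c' d b) l).
  move=> nb; left=> /=; rewrite /c' (introF eqP nb); split=> //.
  rewrite /padded; case: (unlift ord0 l) => [l'|] /=; last by right; exists b.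
  by left; exists (b, l').
case=> [b|[e' [b0 Bb0 e0]]] /=.
  exists (fun l => (padded (x b) (c b) l, padded (x b) (c' d b) l)); split=> // l.
  have [-> |/eqP nb] := eqVneq b b1; last exact: Pid.
  rewrite /padded /c' eqxx; case: (unlift ord0 l) => [l'|] /=; last by right.
  by left; split=> //; left; exists (b1, l').
have nb0 : b0 <> b1 by move=> e; apply: nB1; rewrite -e.
rewrite -e0; exists (fun l => (padded (x b0) (c b0) l, padded (x b0) (c' d b0) l)).
split=> // [l|]; first exact: Pid.
by rewrite /c' (introF eqP nb0).
Qed.

(** Given a family f in a model M, choose representatives, copy them to A, send them
    to N by v and add fresh points. *)
Lemma transfer_trianglelefteq : inhabited A ->
  trianglelefteq (eq_theory T) (eq_theory T').
Proof.
move=> a0 n ar s phi; pose m := width s.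
pose phi' i := sval (cid (translation (phi i))).
have phi'P i := svalP (cid (translation (phi i))).
exists (inr (tuple_imag T' m.+1)), phi' => X [M [B [f [MT _ [g [[injg relg] bijg]]]]]].
have /choice[z fz] b : exists z, f b = proj z by exact: proj_surj.
have hMA : extendable (home M) (to_str A).
  by apply: (models_extendable gA) AT; exact: home_models.
have [y /= [finQ pisoQ]] := extendable_tuple (M := home M) (N := to_str A)
  (J := (B * 'I_m)%type) (fun bl => z bl.1 bl.2) hMA (finite_set0 _)
  (models_piso0 gA (home_models MT) AT).
have [c [injc cx]] : exists c : B -> N,
    injective c /\ forall b b' l, c b <> v (y (b', l)).
  have [h [injh hv]] := infinite_avoid (generic_infinite a0)
    (finite_image (fun bl => v (y bl)) (finite_finset (X := [set: B * 'I_m]))).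
  exists (fun b => h (fsval b)); split; first by move=> b b' /injh/val_inj.
  by move=> b b' l e; apply: (hv (fsval b)); exists (b', l).
have NB := padded_inF (x := fun b l => v (y (b, l))) injc cx.
exists EN, B, (fun b => padded_tuple (fun l => v (y (b, l))) (c b)); split=> //.
exists g; split=> //; split=> // i w; rewrite relg /=.
rewrite (phi'P i (fun j l => y (g (w j), l)) (fun j => c (g (w j)))).
set Q := (_ `|` _) in finQ pisoQ.
have eAM : extendable (home EA) (home M).
  by apply: (models_extendable gA) => //; exact: home_models.
have eMA : extendable (home M) (home EA).
  by apply: (models_extendable gA) => //; exact: home_models.
apply: (@sat_lifts _ _ _ _ MT AE eMA eAM _ _ (phi i) Q _ _ _ _).
  by split; [exact: finQ|exact: pisoQ].
move=> j; rewrite /= fz; exists (fun l => (z (g (w j)) l, y (g (w j), l))); split=> // l.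
by right; exists (g (w j), l).
Qed.

End Transfer.

(** * Ultrahomogeneity from one-point extensions *)

Section Limit.
Variables (sg : rsig) (A : rstr sg) (enumA : nat -> A).
Hypothesis enumA_surj : forall a, exists n, enumA n = a.
Hypothesis extA : extendable (to_str A) (to_str A).

Let fpiso := {P : set (A * A) | finite_set P /\ piso (M := to_str A) (M' := to_str A) P}.

Let step_ex (Pn : fpiso * nat) : exists Q : fpiso,
  [/\ sval Pn.1 `<=` sval Q, exists y, sval Q (enumA Pn.2, y)
    & exists x, sval Q (x, enumA Pn.2)].
Proof.
case: Pn => [[P [finP pisoP]] n] /=; set a := enumA n.
have [y py] := extA finP pisoP a.
have finPy : finite_set (P `|` [set (a, y)]).
  by rewrite finite_setU; split=> //; exact: finite_set1.
have [_ _ back] := extendable_back_and_forth extA extA (conj finPy py).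
have [x [Q [FQ PQ Qx]]] := back a; exists (exist _ Q FQ); split=> /=.
- by move=> p Pp; apply: PQ; left.
- by exists y; apply: PQ; right.
- by exists x.
Qed.

(** Back-and-forth along the enumeration: the n-th step puts the n-th point into the
    domain and the range, and the union of the chain is an automorphism. *)
Lemma extendable_ultrahomogeneous : ultrahomogeneous A.
Proof.
move=> B g h finB embg embh.
have [step stepP] := choice step_ex.
pose P0 := range (fun b => (g b, h b)).
have FP0 : finite_set P0 /\ piso (M := to_str A) (M' := to_str A) P0.
  split; first exact: finite_image.
  have emb_id : embedding (@idfun B) by split.
  have := piso_image embg embh (emb_piso emb_id).
  by apply: piso_sub => _ [b _ <-]; exists (b, b).
pose fix chain n : fpiso := if n is n.+1 then step (chain n, n) else exist _ P0 FP0.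
have chain_le m n : m <= n -> sval (chain m) `<=` sval (chain n).
  move=> /subnK <-; elim: (n - m) => // k IH p /IH; rewrite addSn /=.
  by have [] := stepP (chain (k + m), k + m) => + _ _; apply.
pose U := \bigcup_n sval (chain n).
have pisoU : piso (M := to_str A) (M' := to_str A) U.
  split.
    move=> p q [m _ Pp] [n _ Pq].
    have [_ [eqP _]] := svalP (chain (maxn m n)).
    by apply: eqP; [exact: chain_le (leq_maxl m n) _ Pp
                   |exact: chain_le (leq_maxr m n) _ Pq].
  move=> R w Uw; have /choice[k kP] i : exists n, sval (chain n) (w i).
    by have [n _ Pn] := Uw i; exists n.
  have [_ [_ relP]] := svalP (chain (\max_i k i)).
  by apply: relP => i; apply: chain_le (kP i); exact: leq_bigmax.
have Ul x : exists y, U (x, y).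
  have [n <-] := enumA_surj x; have [_ [y Py] _] := stepP (chain n, n).
  by exists y, n.+1.
have Ur y : exists x, U (x, y).
  have [n <-] := enumA_surj y; have [_ _ [x Px]] := stepP (chain n, n).
  by exists x, n.+1.
have [t tP] := choice Ul; have [t' t'P] := choice Ur.
have [eqU relU] := pisoU.
exists t.
  split; last first.
    exists t' => x; first exact/(eqU _ _ (t'P (t x)) (tP x)).
    exact/(eqU _ _ (tP (t' x)) (t'P x)).
  split; first by move=> x y txy; exact/(eqU _ _ (tP x) (tP y)).
  by move=> R x; exact: (relU R (fun i => (x i, t (x i)))).
apply: funextd => b; have Ub : U (g b, h b) by exists 0 => //; exists b.
exact/(eqU _ _ (tP (g b)) Ub).
Qed.

End Limit.

Lemma finite_extendable_emb (sg : rsig) (B A : rstr sg) :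
  extendable (to_str B) (to_str A) -> finite_str B ->
  piso (set0 : set (to_str B tt * to_str A tt)) ->
  exists g : B -> A, embedding g.
Proof.
move=> ext finB piso0; have [n [f fE]] := finite_range finB.
have [y /= [_ pisoQ]] := extendable_tuple (M := to_str B) (N := to_str A) f ext
  (finite_set0 _) piso0.
have fs b : exists i, f i = b.
  have : [set: B] b by [].
  by rewrite fE => -[i _ <-]; exists i.
have [s sP] := choice fs; exists (y \o s).
have Q b : (set0 `|` range (fun j => (f j, y j))) (b, y (s b)).
  by right; exists (s b); rewrite // sP.
have [eqQ relQ] := pisoQ; split.
  by move=> b b' /= e; apply/(eqQ _ _ (Q b) (Q b')).
by move=> R x; exact: (relQ R (fun i => (x i, y (s (x i))))).
Qed.

(** * Hypergraphs form a Fraisse class *)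

Section Hypergraphs.
Variable r : nat.
Hypothesis r_gt1 : 1 < r.

Local Notation edge A := (rrel (r := A) (R := tt : hyp_sig r)).

(** Hypergraphs of any size; the generic one is infinite. *)
Definition is_hyp (A : rstr (hyp_sig r)) : Prop :=
  forall x : 'I_r -> A, edge A x -> injective x /\ forall p : 'S_r, edge A (x \o p).

(** The injective y lists entries of x, hence it is a permutation of x. *)
Lemma edge_range (A : rstr (hyp_sig r)) (x y : 'I_r -> A) : is_hyp A -> edge A x ->
  injective y -> (forall i, exists j, y i = x j) -> edge A y.
Proof.
move=> hypA Ex injy /choice[s ys].
have injs : injective s by move=> i j sij; apply: injy; rewrite !ys sij.
suff -> : y = x \o perm injs by have [_ symx] := hypA x Ex; exact: symx.
by apply: funextd => i; rewrite /= permE.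
Qed.

Lemma hypergraphs_HP : HP (hypergraphs r).
Proof.
move=> A B g [finB hypB] [injg relg]; split.
  rewrite /finite_str; have -> : [set: A] = g @^-1` [set: B] by [].
  by apply: finite_preimage => // x y _ _; exact: injg.
move=> x /relg Ex; have [inj_gx perm_gx] := hypB _ Ex; split.
  by move=> i j xij; apply: inj_gx; rewrite /= xij.
by move=> p; apply/relg; exact: perm_gx.
Qed.

(** Free amalgamation: B and C are glued along A, and no other edge is added. *)
Lemma hypergraphs_AP : AP (hypergraphs r).
Proof.
move=> A B C g h [finA hypA] [finB hypB] [finC hypC] [injg relg] [injh relh].
pose D0 := (B + {c : C | ~ range h c})%type.
pose h' (c : C) : D0 := match pselect (range h c) with
  | left hc => inl (g (sval (cid2 hc)))
  | right nhc => inr (exist _ c nhc) end.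
have h'h a : h' (h a) = inl (g a).
  rewrite /h'; case: pselect => [ha|[]]; last by exists a.
  by case: cid2 => a' _ /= /injh ->.
have h'inl c b : h' c = inl b -> exists2 a, c = h a & b = g a.
  rewrite /h'; case: pselect => // hc; case: cid2 => a _ /= <- [<-].
  by exists a.
have h'inr c d : h' c = inr d -> c = sval d.
  by rewrite /h'; case: pselect => // nc [<-].
have injh' : injective h'.
  move=> c c'; case e : (h' c) => [b|d]; last first.
    by move=> /esym/h'inr ->; exact: h'inr.
  move=> /esym/h'inl[a' -> ba']; have [a -> ba] := h'inl _ _ e.
  by congr h; apply: injg; rewrite -ba.
pose D := @RStr (hyp_sig r) D0 (fun _ => [set x : 'I_r -> D0 |
  (exists2 y, x = inl \o y & edge B y) \/ (exists2 y, x = h' \o y & edge C y)]).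
exists D, inl, h'; split.
- split.
    rewrite /finite_str.
    have -> : [set: D] = inl @` [set: B] `|` h' @` [set: C].
      apply/seteqP; split=> // -[b|[c nc]] _; [by left; exists b|right; exists c => //].
      by rewrite /h'; case: pselect => // nc'; congr inr; exact: eq_exist.
    by rewrite finite_setU; split; exact: finite_image.
  move=> x [[y -> Ey]|[y -> Ey]].
    have [injy py] := hypB _ Ey; split; first by move=> i j [/injy].
    by move=> p; left; exists (y \o p).
  have [injy py] := hypC _ Ey; split; first by move=> i j /injh'/injy.
  by move=> p; right; exists (y \o p).
- split; first by move=> b b' [].
  case=> x; split=> [Ex|[[y xy Ey]|[y xy Ey]]]; first by left; exists x.
    suff -> : x = y by [].
    by apply: funextd => i; have /(congr1 (@^~ i)) [] := xy.
  have /choice[z zP] i : exists a, y i = h a /\ x i = g a.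
    by have /(congr1 (@^~ i))/esym/h'inl[a ? ?] := xy; exists a.
  have yE : y = h \o z by apply: funextd => i; have [] := zP i.
  have -> : x = g \o z by apply: funextd => i; have [] := zP i.
  by apply/relg/relh; rewrite -yE.
- split=> //; case=> x; split=> [Ex|[[y xy Ey]|[y xy Ey]]]; first by right; exists x.
    have /choice[z zP] i : exists a, x i = h a /\ y i = g a.
      by have /(congr1 (@^~ i))/h'inl[a ? ?] := xy; exists a.
    have yE : y = g \o z by apply: funextd => i; have [] := zP i.
    have -> : x = h \o z by apply: funextd => i; have [] := zP i.
    by apply/relh/relg; rewrite -yE.
  suff -> : x = y by [].
  by apply: funextd => i; apply: injh'; have /(congr1 (@^~ i)) := xy.
- by apply: funextd => a /=; rewrite h'h.
Qed.

Lemma hypergraphs_fraisse : fraisse_class (hypergraphs r).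
Proof.
pose E := @RStr (hyp_sig r) void (fun _ => set0).
have KE : hypergraphs r E.
  split=> // ; rewrite /finite_str.
  by have -> : [set: E] = set0; [apply/seteqP; split=> -[]|exact: finite_set0].
have embE (A : rstr (hyp_sig r)) : exists g : E -> A, embedding g.
  exists (fun e : void => match e with end); split=> [[]|[] x].
  by case: (x (Ordinal (ltnW r_gt1))).
split=> //; first by move=> A [].
- by exists E.
- exact: hypergraphs_HP.
- move=> A B KA KB; have [g embg] := embE A; have [h embh] := embE B.
  have [D [g' [h' [KD eg eh _]]]] := hypergraphs_AP KE KA KB embg embh.
  by exists D, g', h'.
- exact: hypergraphs_AP.
Qed.

End Hypergraphs.

(** * The generic hypergraph *)

Section GenericHypergraph.
Variable r : nat.
Hypothesis r_gt1 : 1 < r.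

Local Notation edge A := (rrel (r := A) (R := tt : hyp_sig r)).

(** A natural number codes a finite list of finite sets, each given by a list of its
    elements; varying the first component provides codes of that list as large as
    desired. *)
Definition decode (n : nat) : seq (seq nat) :=
  if unpickle n is Some kl then (kl : nat * seq (seq nat)).2 else [::].
Arguments decode : simpl never.

Lemma decodeK (k : nat) (l : seq (seq nat)) : decode (pickle (k, l)) = l.
Proof. by rewrite /decode pickleK. Qed.

(** A set is an edge when its largest element codes, among others, the set of the
    remaining ones.  A new large number can thus be given any prescribed edges with
    finitely many smaller ones. *)
Definition code_edge (x : 'I_r -> nat) : Prop :=
  injective x /\ exists j, (forall i, i != j -> x i < x j) /\
  exists2 s, s \in decode (x j) & forall n, n \in s <-> exists2 i, i != j & x i = n.

Definition generic_hyp : rstr (hyp_sig r) :=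
  @RStr (hyp_sig r) nat (fun _ => [set x | code_edge x]).

Lemma generic_hyp_is_hyp : is_hyp generic_hyp.
Proof.
move=> x [injx [j [xj [s sj sP]]]]; split=> // p; split.
  by move=> i i' /injx/perm_inj.
exists ((p^-1)%g j); rewrite /= permKV; split.
  move=> i ij; apply: xj; apply: contraNneq ij => <-.
  by rewrite permK.
exists s => // n; rewrite sP; split=> -[i ij xi].
  exists ((p^-1)%g i); last by rewrite permKV.
  by apply: contraNneq ij => /perm_inj ->.
by exists (p i) => //; apply: contraNneq ij => <-; rewrite permK.
Qed.

Lemma unbounded_injection (f : nat -> nat) m : injective f -> exists k, m <= f k.
Proof.
move=> injf; apply: contrapT => /forallNP fm.
have {}fm k : f k < m by rewrite ltnNge; apply/negP.
pose g (i : 'I_m.+1) : 'I_m := Ordinal (fm i).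
have injg : injective g by move=> i j [/injf/val_inj].
by have := leq_card g injg; rewrite !card_ord ltnn.
Qed.

(** If x is not already matched, it is matched with a large code of the list of
    all sets of images of points that form an edge with x. *)
Lemma generic_hyp_extendable (B : rstr (hyp_sig r)) : is_hyp B ->
  extendable (to_str B) (to_str generic_hyp).
Proof.
move=> hypB P finP [eqw relw] x.
have [n [f PE]] := finite_range finP.
have [[p Pp px]|nPx] := pselect (exists2 p, P p & p.1 = x).
  exists p.2; suff -> : P `|` [set (x, p.2)] = P by [].
  by apply/seteqP; split=> q; [case=> // ->; rewrite -px -surjective_pairing|left].
pose vals : seq nat := [seq (f i).2 | i : 'I_n].
have valsP p : P p -> p.2 \in vals.
  by rewrite PE => -[i _ <-]; apply/mapP; exists i; rewrite // mem_enum.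
(* The new point must form an edge with the points listed in s exactly when
   [good s]. *)
pose good (s : seq nat) := exists (w : 'I_r -> B * nat) (j : 'I_r),
  [/\ forall i, i != j -> P (w i), (w j).1 = x, edge B (fun i => (w i).1)
    & forall n, n \in s <-> exists2 i, i != j & (w i).2 = n].
pose l := [seq s <- [seq mask (b : bitseq) vals | b : (size vals).-tuple bool]
          | `[< good s >]].
have lP (p : pred nat) : filter p vals \in l <-> good (filter p vals).
  rewrite mem_filter; split=> [/andP[/asboolP]|h] //; rewrite (introT (asboolP _) h) /=.
  apply/mapP; exists (map_tuple p (in_tuple vals)); first by rewrite mem_enum.
  by rewrite filter_mask.
have inj_code : injective (fun k : nat => pickle (k, l)).
  by move=> i j /(pcan_inj pickleK) [].
have [k kP] := unbounded_injection (\max_(i <- vals) i).+1 inj_code.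
pose x' := pickle (k, l); exists x'.
have below p : P p -> p.2 < x'.
  move=> /valsP pv; apply: leq_ltn_trans kP.
  exact: (leq_bigmax_seq (P := xpredT) (F := id) p.2 pv).
have eqQ p q : (P `|` [set (x, x')]) p -> (P `|` [set (x, x')]) q ->
    p.1 = q.1 <-> p.2 = q.2.
  move=> [Pp|->] [Pq|->] //=; first exact: eqw.
    split=> e; first by case: nPx; exists p.
    by have := below p Pp; rewrite e ltnn.
  split=> e; first by case: nPx; exists q.
  by have := below q Pq; rewrite -e ltnn.
split=> //; case=> w Qw /=.
have [[j wj]|now] := pselect (exists j, w j = (x, x')); last first.
  apply: (relw tt w) => i; have [//|wi] := Qw i.
  by case: now; exists i.
have injP : injective (fun i => (w i).1) <-> injective (fun i => (w i).2).
  by split=> h i i' e; apply: h; apply/(eqQ _ _ (Qw i) (Qw i')).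
have PwP : injective (fun i => (w i).1) -> forall i, i != j -> P (w i).
  move=> injw i ij; have [//|wi] := Qw i.
  by move: ij; rewrite (injw i j) ?eqxx // wi wj.
split=> [Ew|[injw [j' [wj' [s]]]]].
  have [injw _] := hypB _ Ew; split; first exact/injP.
  exists j; split; first by move=> i ij; rewrite wj; exact/below/PwP.
  pose p n := `[< exists2 i, i != j & (w i).2 = n >].
  have filterP n' : n' \in filter p vals <-> exists2 i, i != j & (w i).2 = n'.
    rewrite mem_filter; split=> [/andP[/asboolP] //|h].
    rewrite /p (introT (asboolP _) h) /=; have [i ij <-] := h.
    exact/valsP/PwP.
  exists (filter p vals) => //; rewrite wj decodeK; apply/lP.
  by exists w, j; split=> //; [exact: PwP|rewrite wj].
have Pw := PwP (injP.2 injw).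
have ej : j' = j.
  apply: contrapT => /eqP j'j; have := wj' j; rewrite eq_sym => /(_ j'j).
  by rewrite wj /= ltnNge ltnW //; exact/below/Pw.
rewrite ej wj decodeK mem_filter => /andP[/asboolP[u [j0 [Pu uj0 Eu us]]] _] sP.
apply: (edge_range hypB Eu); first exact/injP.
move=> i; have [->|ij] := eqVneq i j; first by exists j0; rewrite wj uj0.
have /us[i' i'j0 ui'] : (w i).2 \in s by apply/sP; exists i; rewrite // ej.
by exists i'; apply/(eqw _ _ (Pw i ij) (Pu i' i'j0)).
Qed.

Lemma hyp_piso0 (M N : structure (rel_lang (hyp_sig r))) :
  piso (set0 : set (M tt * N tt)).
Proof.
by split=> // -[] w w0; case: (w0 (Ordinal (ltnW r_gt1))).
Qed.

Lemma generic_hypP : generic_model (hypergraphs r) generic_hyp.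
Proof.
split; first exact: countableP.
- move=> A; split=> [[finA hypA]|[finA [g embg]]].
    split=> //; apply: finite_extendable_emb finA _; last exact: hyp_piso0.
    exact: generic_hyp_extendable.
  have [injg relg] := embg; split=> // x /relg Ex.
  have [inj_gx perm_gx] := generic_hyp_is_hyp Ex; split.
    by move=> i j xij; apply: inj_gx; rewrite /= xij.
  by move=> p; apply/relg; exact: perm_gx.
apply: (@extendable_ultrahomogeneous _ generic_hyp id); first by move=> a; exists a.
exact/generic_hyp_extendable/generic_hyp_is_hyp.
Qed.

Section Extension.
Variable A : rstr (hyp_sig r).
Hypothesis gA : generic_model (hypergraphs r) A.

Lemma generic_is_hyp : is_hyp A.
Proof.
move=> x Ex; have [_ ageA _] := gA.
have /ageA[_ hypX] : age_of A (sub_rstr (range x)).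
  split; first exact/sub_finite/finite_image/finite_finset.
  by exists sval; exact: sub_emb.
pose y i : sub_rstr (range x) := exist _ (x i) (ex_intro2 _ _ i I erefl).
have [injy symy] := hypX y Ex; split=> // i j xij.
by apply: injy; exact: eq_exist.
Qed.

(** The set E describes a hypergraph on X and one new point, written None; it is
    realized in A by universality and ultrahomogeneity. *)
Lemma one_point (X : set A) (E : set ('I_r -> option A)) : finite_set X ->
  (forall w, E w -> injective w /\ forall p : 'S_r, E (w \o p)) ->
  (forall w, (forall i, X (w i)) -> (E (Some \o w) <-> edge A w)) ->
  exists b, ~ X b /\ forall w, (forall i a, w i = Some a -> X a) ->
    (edge A (fun i => odflt b (w i)) <-> E w).
Proof.
move=> finX hypE EX.
pose B := @RStr (hyp_sig r) (option {a | X a})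
  (fun _ => [set w : 'I_r -> option {a | X a} | E (omap sval \o w)]).
have KB : hypergraphs r B.
  split.
    rewrite /finite_str.
    have -> : [set: B] = [set None] `|` Some @` [set: {a | X a}].
      by apply/seteqP; split=> // -[a|] _; [right; exists a|left].
    rewrite finite_setU; split; first exact: finite_set1.
    exact: finite_image (sub_finite finX).
  move=> w Ew; have [injw symw] := hypE _ Ew; split; last exact: symw.
  by move=> i j wij; apply: injw; rewrite /= wij.
pose P := range (fun a : {a | X a} => (Some a : B, sval a)).
have finP : finite_set P by exact: finite_image (sub_finite finX).
have pisoP : piso (M := to_str B) (M' := to_str A) P.
  split; first by move=> _ _ [a _ <-] [b _ <-] /=; split=> [[->] //|/sval_inj ->].
  case=> w /= Pw; have /choice[u uP] i : exists a, w i = (Some a, sval a).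
    by have [a _ <-] := Pw i; exists a.
  have -> : (fun i => (w i).2) = (fun i => sval (u i)) by apply: funextd => i; rewrite uP.
  rewrite -EX; last by move=> i; exact: (svalP (u i)).
  have -> : (fun i => (w i).1) = (fun i => Some (u i)) by apply: funextd => i; rewrite uP.
  done.
have [b [eqb relb]] := generic_ext (None : B) gA KB finP pisoP.
exists b; split.
  move=> Xb; pose b' : {a | X a} := exist _ b Xb.
  have [_ /(_ erefl)] := eqb (Some b', b) (None, b)
    (or_introl (ex_intro2 _ _ b' I erefl)) (or_intror erefl).
  done.
move=> w wX; have /choice[u uP] i : exists p : B * A,
    [/\ (P `|` [set (None, b)]) p, omap sval p.1 = w i & p.2 = odflt b (w i)].
  case e : (w i) => [a|]; last by exists (None, b); split=> //; right.
  have Xa := wX i a e.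
  by exists (Some (exist _ a Xa), a); split=> //; left; exists (exist _ a Xa).
have := relb tt u (fun i => let: And3 h _ _ := uP i in h).
have -> : (fun i => odflt b (w i)) = (fun i => (u i).2).
  by apply: funextd => i; have [] := uP i.
have -> : w = omap sval \o (fun i => (u i).1).
  by apply: funextd => i; have [] := uP i.
by move=> h; split=> /h.
Qed.

End Extension.
End GenericHypergraph.

(** * Hypergraphs have trivial algebraic closure *)

Section Trivial.
Variable r : nat.
Hypothesis r_gt1 : 1 < r.

Local Notation edge A := (rrel (r := A) (R := tt : hyp_sig r)).

(** A point a can be duplicated: its copy b is given the edges of a, and none with a
    itself, so that no edge contains both and they can be interchanged. *)
Lemma clone (A : rstr (hyp_sig r)) (J : finType) (y : J -> A) (a : A) :
  generic_model (hypergraphs r) A ->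
  exists b, (forall j, b <> y j) /\
    same_diag (M := to_str A) (N := to_str A) y
      (fun j => if `[< y j = a >] then b else y j).
Proof.
move=> gA; have hypA := generic_is_hyp gA.
pose E := [set w : 'I_r -> option A | edge A (odflt a \o w)].
have [b [nb bE]] : exists b, ~ range y b /\
    forall w, (forall i c, w i = Some c -> range y c) ->
    (edge A (fun i => odflt b (w i)) <-> E w).
  apply: (one_point gA (finite_image _ finite_finset)) => // w Ew.
  have [injw symw] := hypA _ Ew; split; last exact: symw.
  by move=> i j wij; apply: injw; rewrite /= wij.
have by_ j : b <> y j by move=> e; apply: nb; exists j.
exists b; split=> //; set y' := fun j => _.
have y'E j : y' j = odflt b (if `[< y j = a >] then None else Some (y j)).
  by rewrite /y'; case: ifP.
case=> [[i j]|[[] s]] /=.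
  rewrite /y'; case: asboolP => [->|nia]; case: asboolP => [->|nja] //.
    by split=> [e|/by_ //]; case: nja.
  by split=> [e|e]; [case: nia|case: (by_ i)].
have := bE (fun i => if `[< y (s i) = a >] then None else Some (y (s i))).
have -> : (fun i => odflt b (if `[< y (s i) = a >] then None else Some (y (s i)))) =
    (fun i => y' (s i)).
  by apply: funextd => i; rewrite y'E.
move=> ->; last by move=> i c; case: ifP => // _ [<-]; exists (s i).
rewrite /E /=.
suff -> : odflt a \o (fun i => if `[< y (s i) = a >] then None else Some (y (s i))) =
    (fun i => y (s i)) by [].
by apply: funextd => i /=; case: asboolP => [->|].
Qed.

(** If a formula over X true of a point a outside X had finitely many solutions, a
    copy of a distinct from all of them would be one more solution.  Copies exist
    in the generic model, and back-and-forth yields them in all models. *)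
Lemma hypergraphs_trivial : algebraically_trivial (hypergraphs r).
Proof.
move=> M MT X; have gA := generic_hypP r_gt1.
have AT := generic_models gA; set A := generic_hyp r in gA AT.
have eMA : extendable M (to_str A) := models_extendable gA MT AT.
have eAM : extendable (to_str A) M := models_extendable gA AT MT.
apply/seteqP; split=> a; last first.
  move=> Xa.
  pose G (v : unit + {c | X c}) : sorts (rel_lang (hyp_sig r)) := tt.
  exists (Eqn (Var G (inl tt)) (Var G (inr (exist _ a Xa)))) => //=.
  apply: sub_finite_set (finite_set1 (fun=> a)) => f /= fa.
  by apply: funextd => -[].
move=> [phi phia finS]; apply: contrapT => nXa.
have [Y [finY hY]] := sat_back_and_forth (models_back_and_forth gA MT MT) phi.
pose e (d : M tt) := with_params (M := M) (s := tt) X (fun _ : unit => d).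
(* The parameters that matter, a and the solutions. *)
pose Z := [set flat (e a) u | u in Y] `|` [set a] `|` [set d | sat phi (e d)].
have finZ : finite_set Z.
  rewrite !finite_setU; split; first split; [exact: finite_image|exact: finite_set1|].
  apply: sub_finite_set (finite_image (fun g => g tt) finS) => d /= phid.
  by exists (fun=> d).
have [n [f ZE]] := finite_range finZ.
have [y /= [finQ pisoQ]] := extendable_tuple (M := M) (N := to_str A) f eMA
  (finite_set0 _) (hyp_piso0 r_gt1 _ _).
set Q := (_ `|` _) in finQ pisoQ; have [eqQ _] := pisoQ.
have Qf j : Q (f j, y j) by right; exists j.
have [ia _ fia] : range f a by rewrite -ZE; left; right.
have [b' [nb' yy']] := clone y (y ia) gA.
have [b pisob] := eAM _ (finite_swap finQ) (piso_swap pisoQ) b'.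
pose z j := if `[< y j = y ia >] then b else f j.
have yaP j : y j = y ia <-> f j = a.
  by rewrite -fia; have := eqQ _ _ (Qf j) (Qf ia); rewrite /=; tauto.
have fz : same_diag (M := M) (N := M) f z.
  apply: (@same_diag_trans _ _ _ (to_str A) _ _ y).
    by apply/(same_diagP (M := M) (N := to_str A)); apply: piso_sub pisoQ => _ [j _ <-].
  apply: same_diag_trans yy' _; apply/(same_diagP (M := to_str A) (N := M)).
  apply: piso_sub pisob => _ [j _ <-]; rewrite /z /=.
  by case: asboolP => _; [right|left].
have finfz : finite_set (range (fun j => (f j, z j))).
  exact/finite_image/finite_finset.
have /hY abP := conj finfz ((same_diagP f z).1 fz).
have phib : sat phi (e b).
  apply: (abP (e a) (e b) _).1 phia => -[[]|c] Yc.
    by exists ia => //; rewrite /z /flat /= (introT (asboolP _) _) // fia.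
  have [j _ fj] : range f (flat (e a) (inr c)) by rewrite -ZE; left; left; exists (inr c).
  exists j => //; rewrite /z; case: asboolP => [/yaP fja|_]; last by rewrite fj.
  by case: nXa; rewrite -fja fj; exact: (svalP c).
have [j _ fj] : range f b by rewrite -ZE; right.
have [eqb _] := pisob; apply: (nb' j).
by apply: esym; apply/(eqb (y j, f j) (b', b)); [left; exact: Qf|right|exact: fj].
Qed.

End Trivial.

(** * Products of generic models *)

Section Factor.
Variables (n : nat) (sgs : 'I_n -> rsig) (Ks : forall i, str_class (sgs i)).
Variable M : forall i, rstr (sgs i).
Hypothesis fraisseK : forall i, fraisse_class (@Ks i).
Hypothesis countM : countable [set: prod_str M].
Hypothesis coverM : forall X : set (prod_str M), finite_set X ->
  exists (B : forall i, rstr (sgs i)) (g : forall i, B i -> M i),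
    [/\ forall i, Ks (B i), forall i, embedding (g i) & X `<=` range (prod_map g)].
Hypothesis univM : forall B : forall i, rstr (sgs i), (forall i, Ks (B i)) ->
  exists g : forall i, B i -> M i, forall i, embedding (g i).
Hypothesis homM : forall (B : forall i, rstr (sgs i)) (g h : forall i, B i -> M i),
  (forall i, Ks (B i)) -> (forall i, embedding (g i)) -> (forall i, embedding (h i)) ->
  exists2 t : forall i, M i -> M i,
    forall i, isomorphism (t i) & prod_map t \o prod_map g = prod_map h.

(** The i-th factor inherits universality and homogeneity from the product, by
    completing structures and maps at i with fixed ones at the other indices; these
    must be inhabited, which the point b0 ensures. *)
Lemma factor_generic (b0 : prod_str M) i : generic_model (@Ks i) (M i).
Proof.
have [B0 [g0 [KB0 embg0 b0B]]] := coverM (finite_set1 b0).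
have [y0 _ _] := b0B b0 erefl.
have upd (m : M i) : exists2 x : prod_str M, x i = m & True.
  by exists (dfwith b0 m); rewrite ?dfwith_in.
have [finK _ hpK _ _] := fraisseK i.
have ageK A : age_of (M i) A -> Ks A.
  move=> [finA [g embg]].
  have /choice[x xP] m : exists x : prod_str M, x i = g m.
    by have [x] := upd (g m); exists x.
  have [B [g' [KB embg' xB]]] := coverM (finite_image x finA).
  have /choice[k kP] m : exists b, g' i b = g m.
    have [|b _ bx] := xB (x m); first by exists m.
    by exists (b i); rewrite -xP -bx.
  apply: (hpK _ _ k) (KB i) _.
  have [injg relg] := embg; have [injg' relg'] := embg' i.
  split; first by move=> m m' e; apply: injg; rewrite -!kP e.
  move=> R z; rewrite relg relg'; suff -> : g \o z = g' i \o (k \o z) by [].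
  by apply: funextd => l /=; rewrite kP.
split.
- have -> : [set: M i] = (fun x : prod_str M => x i) @` [set: prod_str M].
    by apply/seteqP; split=> // m _; have [x xm _] := upd m; exists x.
  exact: card_le_trans (card_image_le _ _) countM.
- move=> A; split=> [KA|]; last exact: ageK.
  split; first exact: finK.
  pose B := dfwith B0 A.
  have BiA : B i = A by rewrite /B dfwith_in.
  have KB j : Ks (B j).
    have [<-|ij] := eqVneq i j; first by rewrite BiA.
    by rewrite /B dfwith_out.
  have [g embg] := univM KB; move: (g i) (embg i); rewrite BiA => k embk.
  by exists k.
move=> A g h finA embg embh.
have KA : Ks A by apply: ageK; split=> //; exists g.
(* A structure and two maps from it are packed together, so that all three can be
   updated at the index i by a single dependent update. *)
pose T j := {X : rstr (sgs j) & ((X -> M j) * (X -> M j))%type}.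
pose F : forall j, T j :=
  dfwith (fun j => existT _ (B0 j) (g0 j, g0 j) : T j) (existT _ A (g, h) : T i).
have Fi : F i = existT _ A (g, h) by exact: dfwith_in.
have Fj j : i != j -> F j = existT _ (B0 j) (g0 j, g0 j) by move=> ij; exact: dfwith_out.
have FP j : [/\ Ks (projT1 (F j)), embedding (projT2 (F j)).1
             & embedding (projT2 (F j)).2].
  by have [<-|ij] := eqVneq i j; [rewrite Fi|rewrite Fj].
have [t isot tP] := homM (B := fun j => projT1 (F j)) (g := fun j => (projT2 (F j)).1)
  (h := fun j => (projT2 (F j)).2) (fun j => let: And3 h _ _ := FP j in h)
  (fun j => let: And3 _ h _ := FP j in h) (fun j => let: And3 _ _ h := FP j in h).
exists (t i) => //.
have : forall c : projT1 (F i), t i ((projT2 (F i)).1 c) = (projT2 (F i)).2 c.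
  move=> c; have y j : projT1 (F j).
    by have [<-|ij] := eqVneq i j; [exact: c|rewrite (Fj j ij); exact: (y0 j)].
  have := congr1 (fun f => f (dfwith y c) i) tP.
  by rewrite /= /prod_map dfwith_in.
by rewrite Fi => tF; apply: funextd.
Qed.

Lemma prod_map_iso (t : forall i, M i -> M i) : (forall i, isomorphism (t i)) ->
  isomorphism (A := prod_str M) (B := prod_str M) (prod_map t).
Proof.
move=> isot.
have invP i : exists t' : M i -> M i, cancel (t i) t' /\ cancel t' (t i).
  by have [t' ? ?] := (isot i).2; exists t'.
pose t' i := sval (cid (invP i)).
split; last first.
  exists (prod_map t') => x; apply: functional_extensionality_dep => i.
    by have [tK _] := svalP (cid (invP i)); exact: tK.
  by have [_ tK] := svalP (cid (invP i)); exact: tK.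
split.
  move=> x y xy; apply: functional_extensionality_dep => i.
  by have [[injt _] _] := isot i; apply: injt; have /(congr1 (@^~ i)) := xy.
case=> i R x; have [[_ relt] _] := isot i.
exact: (relt R (fun j => x j i)).
Qed.

Definition with_at (T : Type) k (z : 'I_k -> T) (j : 'I_k) (x : T) : 'I_k -> T :=
  fun l => if l == j then x else z l.

Definition factor_rel i (R : sgs i) : prod_sig sgs := Tagged (fun i => sgs i) R.

(** Equality of i-th coordinates is not expressible in the language of the product;
    indiscernibility by the relations of the i-th factor is the closest definable
    substitute. *)
Definition indisc (N : structure (rel_lang (prod_sig sgs))) i (x y : N tt) : Prop :=
  forall (R : sgs i) (j : 'I_(rarity R)) (z : 'I_(rarity R) -> N tt),
    rint (s := N) (R := factor_rel R : rsym (rel_lang _)) (with_at z j x) <->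
    rint (s := N) (R := factor_rel R : rsym (rel_lang _)) (with_at z j y).

Lemma def_indisc i : exists p : form (L := rel_lang (prod_sig sgs)) (fun _ : 'I_2 => tt),
  forall N e, sat p e <-> indisc (N := N) i (e ord0) (e ord_max).
Proof.
apply: def_form.
apply: def_forallfin => R; apply: def_forallfin => j.
apply: (@def_alls (rel_lang (prod_sig sgs)) _ _ tt 'I_(rarity R) (fun N e z =>
    rint (s := N) (R := factor_rel R : rsym (rel_lang _)) (with_at z j (e ord0)) <->
    rint (s := N) (R := factor_rel R : rsym (rel_lang _)) (with_at z j (e ord_max)))).
apply: def_iff; apply: def_rel => l; rewrite /with_at.
  by case: (l == j); [exact: tdef_id (inl ord0)|exact: tdef_id (inr l)].
by case: (l == j); [exact: tdef_id (inl ord_max)|exact: tdef_id (inr l)].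
Qed.

Local Notation PM := (prod_str M).
Local Notation ind i := (indisc (N := to_str PM) i).

Lemma indisc_sym i x y : ind i x y -> ind i y x.
Proof. by move=> xy R j z; rewrite xy. Qed.

Lemma indisc_trans i x y z : ind i x y -> ind i y z -> ind i x z.
Proof. by move=> xy yz R j w; rewrite xy. Qed.

Lemma indisc_coord i (x y : PM) : x i = y i -> ind i x y.
Proof.
move=> xy R j z /=.
suff -> : (fun l => with_at z j x l i) = (fun l => with_at z j y l i) by [].
by apply: funextd => l; rewrite /with_at; case: eqP.
Qed.

(** Replace the entries one at a time. *)
Lemma indisc_rel i (R : sgs i) (z z' : 'I_(rarity R) -> PM) :
  (forall j, ind i (z j) (z' j)) ->
  rrel (r := PM) (R := factor_rel R) z <-> rrel (r := PM) (R := factor_rel R) z'.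
Proof.
move=> zz'; pose hyb k (j : 'I_(rarity R)) := if j < k then z' j else z j.
have hybE k : k <= rarity R -> rrel (r := PM) (R := factor_rel R) z <->
    rrel (r := PM) (R := factor_rel R) (hyb k).
  elim: k => [|k IH] kR.
    by suff -> : hyb 0 = z by []; apply: funextd.
  rewrite (IH (ltnW kR)); pose j := Ordinal kR.
  have -> : hyb k = with_at (hyb k) j (z j).
    apply: funextd => l; rewrite /with_at; case: eqP => // ->.
    by rewrite /hyb ltnn.
  have -> : hyb k.+1 = with_at (hyb k) j (z' j).
    apply: funextd => l; rewrite /with_at /hyb ltnS leq_eqVlt -val_eqE /=.
    by case: eqP => //= lk; congr z'; apply: val_inj.
  exact: (zz' j R j (hyb k)).
rewrite (hybE _ (leqnn _)); suff -> : hyb (rarity R) = z' by [].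
by apply: funextd => l; rewrite /hyb ltn_ord.
Qed.

Definition swap (T : Type) (x y z : T) : T :=
  if `[< z = x >] then y else if `[< z = y >] then x else z.

Lemma swapK (T : Type) (x y : T) : involutive (swap x y).
Proof.
move=> z; rewrite /swap; case: (asboolP (z = x)) => [->|zx].
  by case: asboolP => [->|yx] //; case: asboolP.
case: (asboolP (z = y)) => [->|zy]; first by case: asboolP.
by case: asboolP => //; case: asboolP.
Qed.

(** Points that no relation distinguishes can be exchanged by an automorphism, even
    when their coordinates differ. *)
Lemma swap_iso (x y : PM) : (forall i, ind i x y) ->
  isomorphism (A := PM) (B := PM) (swap x y).
Proof.
move=> xy; split; last by exists (swap x y); exact: swapK.
split; first exact: inv_inj (swapK x y).
case=> i R z; apply: (indisc_rel (R := R)) => j; rewrite /= /swap.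
case: asboolP => [->|_]; first exact: xy.
case: asboolP => [->|_]; first exact/indisc_sym/xy.
exact: indisc_coord.
Qed.

End Factor.

(** * Indecomposability *)

Section HypergraphFactor.
Variable r : nat.
Hypothesis r_gt1 : 1 < r.

Local Notation edge A := (rrel (r := A) (R := tt : hyp_sig r)).

Variable A : rstr (hyp_sig r).
Hypothesis gA : generic_model (hypergraphs r) A.

Let hypA : is_hyp A := generic_is_hyp gA.
Let k0 : 'I_r := Ordinal (ltnW r_gt1).

Lemma edge_ex : exists a : 'I_r -> A, edge A a.
Proof.
pose B := @RStr (hyp_sig r) 'I_r (fun _ => [set x : 'I_r -> 'I_r | injective x]).
have [_ ageA _] := gA.
have /ageA[_ [k [_ relk]]] : hypergraphs r B.
  split; first exact: finite_finset.
  by move=> x /= injx; split=> // p; exact: inj_comp injx perm_inj.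
by exists (k \o id); exact/(relk tt).
Qed.

(** The other atomic properties of an injective r-tuple are determined: a substitution
    of its entries is an edge only if it is a permutation. *)
Lemma injective_same_diag (x y : 'I_r -> A) : injective x -> injective y ->
  (edge A x <-> edge A y) -> same_diag (M := to_str A) (N := to_str A) x y.
Proof.
move=> injx injy xy [[i j]|[[] s]] /=.
  by split=> [/injx ->|/injy ->].
suff edges (z : 'I_r -> A) : injective z ->
    (edge A (fun i => z (s i)) <-> injective s /\ edge A z).
  by rewrite (edges x injx) (edges y injy) xy.
move=> injz; split=> [Ez|[injs Ez]]; last first.
  apply: (edge_range hypA Ez); first exact: inj_comp injs.
  by move=> i; exists (s i).
have [injzs _] := hypA Ez.
have injs : injective s by move=> i j sij; apply: injzs; rewrite sij.
split=> //; apply: (edge_range hypA Ez) => // i.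
by exists ((perm injs)^-1%g i); rewrite -[s _](permE injs) permKV.
Qed.

(** Replace one entry of the edge by a point that lies in no common edge with the
    others. *)
Lemma nonedge_ex (a : 'I_r -> A) : edge A a ->
  exists e, (forall k, e <> a k) /\
    let a' := fun k => if k == k0 then e else a k in injective a' /\ ~ edge A a'.
Proof.
move=> Ea; have [inja _] := hypA Ea.
pose E := [set w : 'I_r -> option A | exists2 w', w = Some \o w' & edge A w'].
have [e [ne eE]] : exists e, ~ range a e /\
    forall w, (forall i c, w i = Some c -> range a c) ->
    (edge A (fun i => odflt e (w i)) <-> E w).
  apply: (one_point gA (finite_image _ finite_finset)) => // [w [w' -> Ew]|w _].
    have [injw symw] := hypA Ew; split; first by move=> i j [/injw].
    by move=> p; exists (w' \o p).
  split=> [[w' ww' Ew']|Ew]; last by exists w.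
  suff -> : w = w' by [].
  by apply: funextd => i; have /(congr1 (@^~ i)) [] := ww'.
have nea k : e <> a k by move=> ek; apply: ne; exists k.
exists e; split=> //=; split.
  move=> i j; case: eqVneq => [->|_]; case: eqVneq => [->|_] //.
  - by move=> /esym/esym/nea.
  - by move=> /esym/nea.
  - exact: inja.
move=> Ea'; have := eE (fun k => if k == k0 then None else Some (a k)).
have -> : (fun k => odflt e (if k == k0 then None else Some (a k))) =
    (fun k => if k == k0 then e else a k) by apply: funextd => k; case: eqP.
case=> [i c|/(_ Ea')[w /(congr1 (@^~ k0))]]; last by rewrite eqxx.
by case: eqP => // _ [<-]; exists i.
Qed.

Definition pair (c d : A) (i : 'I_2) : A := if i == ord0 then c else d.

(** Give a new point e with d and d' the edges that c' has with c; only r = 2 offers a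
    choice here. *)
Lemma common_neighbour (c c' d d' : A) : c <> c' -> exists e,
  same_diag (M := to_str A) (N := to_str A) (pair c c') (pair d e) /\
  same_diag (M := to_str A) (N := to_str A) (pair c c') (pair d' e).
Proof.
move=> cc'; pose h (o : option A) := if o is Some _ then c else c'.
pose E := [set w : 'I_r -> option A | (exists2 w', w = Some \o w' & edge A w') \/
  ((exists i, w i = None) /\ edge A (h \o w))].
have [e [ne eE]] : exists e, ~ [set d; d'] e /\
    forall w, (forall i a, w i = Some a -> [set d; d'] a) ->
    (edge A (fun i => odflt e (w i)) <-> E w).
  apply: (one_point gA (finite_set2 d d')) => [w [[w' -> Ew]|[[i wi] Ew]]|w _].
  - have [injw symw] := hypA Ew; split; first by move=> i j [/injw].
    by move=> p; left; exists (w' \o p).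
  - have [injw symw] := hypA Ew; split.
      by move=> j l wjl; apply: injw; rewrite /= wjl.
    move=> p; right; split; last exact: symw.
    by exists ((p^-1)%g i); rewrite /= permKV.
  split=> [[[w' ww' Ew']|[[i]]]//|Ew]; last by left; exists w.
  suff -> : w = w' by [].
  by apply: funextd => i; have /(congr1 (@^~ i)) [] := ww'.
exists e.
suff good b : [set d; d'] b ->
    same_diag (M := to_str A) (N := to_str A) (pair c c') (pair b e).
  by split; apply: good; [left|right].
move=> db; have be : b <> e by move=> be; apply: ne; rewrite -be.
case=> [[i j]|[[] s]] /=.
  rewrite /pair; case: eqP => _; case: eqP => _ //.
  by split=> /esym.
pose w i := if s i == ord0 then Some b else None.
have := eE w; have -> : (fun i => odflt e (w i)) = (fun i => pair b e (s i)).
  by apply: funextd => i; rewrite /w /pair; case: eqP.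
move=> ->; last by move=> i a; rewrite /w; case: eqP => // _ [<-].
have hw : h \o w = (fun i => pair c c' (s i)).
  by apply: funextd => i; rewrite /h /w /pair /=; case: eqP.
have noconst (x : 'I_r -> A) a : edge A x -> ~ (forall i, x i = a).
  move=> Ex xa; have [injx _] := hypA Ex.
  by have /injx [] : x (Ordinal r_gt1) = x k0 by rewrite !xa.
split=> [Ecc|[[w' ww' Ew']|[_]]]; last by rewrite hw.
  right; split; last by rewrite hw.
  apply: contrapT => /forallNP nw; apply: (noconst _ c Ecc) => i.
  have := nw i; rewrite /w /pair; case: eqP => //.
case: (noconst _ b Ew') => i; have := congr1 (@^~ i) ww'.
by rewrite /w /=; case: eqP => // _ [].
Qed.

Variables (n : nat) (sgs : 'I_n -> rsig) (M : forall i, rstr (sgs i)).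
Local Notation PM := (prod_str M).
Hypothesis homM : forall i, ultrahomogeneous (M i).
Variable u : A -> PM.
Hypothesis inj_u : injective u.
Hypothesis type_u : forall k (a a' : 'I_k -> A),
  qftp (M := to_str A) (G := fun=> tt) a = qftp (M := to_str A) (G := fun=> tt) a' <->
  forall p : form (L := rel_lang (prod_sig sgs)) (fun _ : 'I_k => tt),
    sat (M := to_str PM) p (u \o a) <-> sat (M := to_str PM) p (u \o a').

Lemma same_diag_sat_u k (a a' : 'I_k -> A)
    (p : form (L := rel_lang (prod_sig sgs)) (fun _ : 'I_k => tt)) :
  same_diag (M := to_str A) (N := to_str A) a a' ->
  sat (M := to_str PM) p (u \o a) <-> sat (M := to_str PM) p (u \o a').
Proof.
move=> aa'; move: p; apply/type_u.
have [_ _ homA] := gA.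
have [t isot ta] := piso_aut homA (finite_image _ finite_finset)
  ((same_diagP (M := to_str A) (N := to_str A) a a').1 aa').
have -> : a' = t \o a.
  by apply: funextd => i; apply: esym; apply: (ta (a i, a' i)); exists i.
by apply/seteqP; split=> p [qp satp]; split=> //;
  [exact: (sat_iso isot p a).1|exact: (sat_iso isot p a).2].
Qed.

Lemma sat_u_edge (a a' : 'I_r -> A) :
  (forall p : form (L := rel_lang (prod_sig sgs)) (fun _ : 'I_r => tt),
    sat (M := to_str PM) p (u \o a) <-> sat (M := to_str PM) p (u \o a')) ->
  edge A a -> edge A a'.
Proof.
move=> /type_u aa' Ea.
pose G (_ : 'I_r) : sorts (rel_lang (hyp_sig r)) := tt.
pose p : form G := Rel (R := tt : rsym (rel_lang (hyp_sig r))) (fun i => Var G i).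
have : qftp (M := to_str A) (G := G) a p by split.
by rewrite aa' => -[].
Qed.

Let F i (c d : A) : Prop := indisc (N := to_str PM) i (u c) (u d).

(** Indiscernibility at a coordinate is definable in the product, so it pulls
    back to an invariant equivalence relation on A.  If it relates two distinct
    points, it relates any two points through a common neighbour. *)
Lemma indisc_dichotomy i : (forall c d, F i c d) \/ (forall c d, F i c d -> c = d).
Proof.
have [|/existsNP[c /existsNP[c' /not_implyP[Fcc' cc']]]] :=
  pselect (forall c d, F i c d -> c = d); first by right.
left=> d d'; have [e [cde cd'e]] := common_neighbour d d' cc'.
have [p pP] := @def_indisc n sgs i.
have inv b : same_diag (M := to_str A) (N := to_str A) (pair c c') (pair b e) -> F i b e.
  move=> /(same_diag_sat_u p); rewrite !pP /=.
  by rewrite /pair /= => -[+ _]; apply.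
exact: indisc_trans (inv d cde) (indisc_sym (inv d' cd'e)).
Qed.

(** Call a factor total when all points of A are indiscernible there; at the other
    factors u is injective.  Let the edge a and the non-edge a' differ only in one
    entry, e instead of a k0.  If no factor separated them, then the type of u a
    would not change when its entry u (a k0) is replaced by the point w with the
    coordinates of u e at the non-total factors: apply an automorphism in each of
    those factors.  As w and u e are indiscernible at all factors, exchanging
    them leads on to u a'.  So u a and u a' would have the same type, contrary to
    the hypothesis on u. *)
Lemma separating_factor : exists i,
  injective (fun c => u c i) /\
  exists (R : sgs i) (s : 'I_(rarity R) -> 'I_r) (a a' : 'I_r -> A),
    [/\ edge A a, injective a', ~ edge A a' &
        ~ (rrel (fun l => u (a (s l)) i) <-> rrel (fun l => u (a' (s l)) i))].
Proof.
have [a Ea] := edge_ex; have [inja _] := hypA Ea.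
have [e [ea [inja' nEa']]] := nonedge_ex Ea; set a' := fun k => _ in inja' nEa'.
pose total i := forall c d, F i c d.
have inj_total i : ~ total i -> injective (fun c => u c i).
  move=> nt c d ucd; have [//|Feq] := indisc_dichotomy i.
  exact/Feq/indisc_coord.
pose pairs i := range (fun k => (u (a k) i, u (a' k) i)).
have [i [nti npiso]] : exists i,
    ~ total i /\ ~ piso (M := to_str (M i)) (M' := to_str (M i)) (pairs i).
  apply: contrapT => /forallNP pisos.
  have {}pisos i : ~ total i -> piso (M := to_str (M i)) (M' := to_str (M i)) (pairs i).
    by move=> nti; apply: contrapT => np; case: (pisos i).
  pose w : PM := fun i => if `[< total i >] then u (a k0) i else u e i.
  pose z k := if k == k0 then w else u (a k).
  have autP i : exists2 t : M i -> M i, isomorphism t &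
      forall k, t (u (a k) i) = z k i.
    have [ti|nti] := pselect (total i).
      exists id; first by split; [split|exists id].
      by move=> k; rewrite /z; case: eqP => // ->; rewrite /w (introT (asboolP _) ti).
    have [t isot tP] := piso_aut (@homM i) (finite_image _ finite_finset) (pisos i nti).
    exists t => // k; rewrite (tP (u (a k) i, u (a' k) i)); last by exists k.
    by rewrite /= /a' /z; case: eqP => //; rewrite /w (introF (asboolP _) nti).
  pose t i := sval (cid2 (autP i)).
  have isot i : isomorphism (t i) by rewrite /t; case: cid2.
  have ta i k : t i (u (a k) i) = z k i by rewrite /t; case: cid2 => ? ? /= ->.
  have w_u k : k != k0 -> u (a k) <> w.
    move=> kk0 ukw; have [[j ntj]|allt] := pselect (exists j, ~ total j).
      apply: (ea k); apply: (inj_total j ntj); have := congr1 (@^~ j) ukw.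
      by rewrite /w (introF (asboolP _) ntj).
    have wE : w = u (a k0).
      apply: functional_extensionality_dep => j; rewrite /w; case: asboolP => // ntj.
      by case: allt; exists j.
    by move: kk0; rewrite wE in ukw; rewrite (inja _ _ (inj_u ukw)) eqxx.
  have w_e j : indisc (N := to_str PM) j w (u e).
    have [tj|ntj] := pselect (total j); last first.
      by apply: indisc_coord; rewrite /w (introF (asboolP _) ntj).
    apply: indisc_trans (tj (a k0) e).
    by apply: indisc_coord; rewrite /w (introT (asboolP _) tj).
  apply/nEa'/(sat_u_edge _ Ea) => p.
  have az : prod_map t \o (u \o a) = z.
    apply: funextd => k; apply: functional_extensionality_dep => j.
    by rewrite /= /prod_map ta.
  have za' : swap w (u e) \o z = u \o a'.
    apply: funextd => k; rewrite /= /swap /z /a'; case: eqVneq => [_|kk0].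
      by rewrite (introT (asboolP _)).
    rewrite (introF (asboolP _) (w_u k kk0)) (introF (asboolP _)) // => /inj_u ak.
    by case: (ea k).
  rewrite (sat_iso (prod_map_iso isot) p (u \o a)) az.
  by rewrite (sat_iso (swap_iso w_e) p z) za'.
exists i; split; first exact: inj_total.
apply: contrapT => nR; apply: npiso; split.
  move=> _ _ [k _ <-] [l _ <-] /=.
  by split=> [/(inj_total i nti)/inja ->|/(inj_total i nti)/inja' ->].
move=> R x xP; have /choice[s sP] l : exists k, (u (a k) i, u (a' k) i) = x l.
  by have [k _ <-] := xP l; exists k.
apply: contrapT => nrel; apply: nR; exists R, s, a, a'; split=> // rel; apply: nrel.
have -> : (fun l => (x l).1) = (fun l => u (a (s l)) i).
  by apply: funextd => l; rewrite -sP.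
have -> // : (fun l => (x l).2) = (fun l => u (a' (s l)) i).
by apply: funextd => l; rewrite -sP.
Qed.

(** At a separating factor, the relation that separates one edge from one non-edge
    separates every edge from every injective non-edge, since injective r-tuples
    have only these two types. *)
Lemma separating_factor_reflects : exists i, forall P : set (A * A),
  piso (M := to_str (M i)) (M' := to_str (M i)) ((fun p => (u p.1 i, u p.2 i)) @` P) ->
  piso (M := to_str A) (M' := to_str A) P.
Proof.
have [i [injv [R [s [a [a' [Ea inja' nEa' nR]]]]]]] := separating_factor.
have [inja _] := hypA Ea.
exists i => P [eqP relP].
have eqA p q : P p -> P q -> p.1 = q.1 <-> p.2 = q.2.
  move=> Pp Pq; have /= [h1 h2] :=
    eqP _ _ (ex_intro2 _ _ p Pp erefl) (ex_intro2 _ _ q Pq erefl).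
  by split=> e; apply: injv; [apply: h1|apply: h2]; rewrite e.
pose G (_ : 'I_r) : sorts (rel_lang (prod_sig sgs)) := tt.
pose phi : form G := Rel (R := factor_rel R : rsym (rel_lang (prod_sig sgs)))
  (fun l => Var G (s l)).
have sep x y : edge A x -> injective y -> ~ edge A y ->
    ~ (rrel (fun l => u (x (s l)) i) <-> rrel (fun l => u (y (s l)) i)).
  move=> Ex injy nEy xy; apply: nR; have [injx _] := hypA Ex.
  have ax := same_diag_sat_u phi (injective_same_diag inja injx _).
  have ay := same_diag_sat_u phi (injective_same_diag inja' injy _).
  by rewrite /= in ax ay; rewrite ax // xy ay.
split=> //; case=> x Px /=.
have inj12 : injective (fun l => (x l).1) <-> injective (fun l => (x l).2).
  by split=> h j l e; apply: h; apply/(eqA _ _ (Px j) (Px l)).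
have rel12 : rrel (fun l => u (x (s l)).1 i) <-> rrel (fun l => u (x (s l)).2 i).
  by apply: (relP R (fun l => (u (x (s l)).1 i, u (x (s l)).2 i))) => l; exists (x (s l)).
split=> Ex; apply: contrapT => nE; have [injx _] := hypA Ex.
  by apply: (sep _ _ Ex _ nE rel12); exact/inj12.
by apply: (sep _ _ Ex _ nE (iff_sym rel12)); exact/inj12.
Qed.

End HypergraphFactor.

Theorem proposition4p9 (r : nat) (hr : 2 <= r) :
  [/\ fraisse_class (hypergraphs r),
      algebraically_trivial (hypergraphs r)
    & indecomposable (hypergraphs r)].
Proof.
split; [exact: hypergraphs_fraisse|exact: hypergraphs_trivial|].
move=> n sgs Ks [_ KsP [A [B [u0 [gA prodB inj_u0 type_u0]]]]].
have [M [[th isoth] cM covM uniM homM]] := prodB.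
pose u := th \o u0.
have [a _] := edge_ex gA.
pose k0 : 'I_r := Ordinal (ltnW hr).
have gM i : generic_model (Ks i) (M i).
  exact: (factor_generic (fun i => (KsP i).1) cM covM uniM homM (u (a k0))).
have injth : injective th by case: isoth => -[].
have type_u k (a1 a2 : 'I_k -> A) :
    qftp (M := to_str A) (G := fun=> tt) a1 = qftp (M := to_str A) (G := fun=> tt) a2 <->
    forall p : form (L := rel_lang (prod_sig sgs)) (fun _ : 'I_k => tt),
      sat (M := to_str (prod_str M)) p (u \o a1) <->
      sat (M := to_str (prod_str M)) p (u \o a2).
  rewrite type_u0; split=> [tp12 p|tp12].
    rewrite -(sat_iso isoth p (u0 \o a1)) -(sat_iso isoth p (u0 \o a2)).
    by have /seteqP[h1 h2] := tp12; split=> [/h1|/h2].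
  apply/seteqP; split=> p satp; apply/(sat_iso isoth)/tp12;
    exact: (sat_iso isoth p _).1 satp.
have [i refl] := separating_factor_reflects hr gA (fun i => let: And3 _ _ h := gM i in h)
  (inj_comp injth inj_u0) type_u.
exists i; apply: (transfer_trianglelefteq gA (gM i) (KsP i).2 (v := fun c => u c i) refl).
exact: inhabits (a k0).
Qed.
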